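(* Let $F:\mathbb{P}^N_{\mathbb{C}_p}\to\mathbb{P}^N_{\mathbb{C}_p}$ be a lift of Frobenius on $\mathbb{P}^N_{\mathbb{C}_p}$. Let $\{b_i\}_{i\ge 0}$ be a sequence of points in $\mathbb{P}^N_{\mathbb{C}_p}(\mathbb{C}_p)$ satisfying $F(b_i)=b_{i-1}$ for all $i\ge 1$. Let $V$ be a subvariety of $\mathbb{P}^N_{\mathbb{C}_p}$. If there exists a subsequence $\{b_{n_i}\}_{i\ge 0}$ (with $n_0<n_1<\cdots$) such that $d(b_{n_i},V)\to 0$ as $i\to\infty$, then $b_{n_i}\in V$ for all $i$ large enough, and there exists $r\ge 0$ such that $\{b_i\}_{i\ge 0}\subseteq\bigcup_{i=0}^{r}F^i(V)$.
   Context: $p$ is a prime and $\mathbb{C}_p$ is the completion of an algebraic closure of $\mathbb{Q}_p$, with norm $|\cdot|$, valuation ring $\mathbb{C}_p^{\circ}$ and maximal ideal $\mathbb{C}_p^{\circ\circ}$. A lift of Frobenius on $\mathbb{P}^N_{\mathbb{C}_p}$ is an endomorphism of the form $$F:[x_0:\cdots:x_N]\mapsto [x_0^q+p'P_0(x_0,\dots,x_N):\cdots:x_N^q+p'P_N(x_0,\dots,x_N)],$$ where $q=p^s$ with $s\geq 1$, $p'\in\mathbb{C}_p^{\circ\circ}$, and $P_0,\dots,P_N\in\mathbb{C}_p^{\circ}[x_0,\dots,x_N]$ are homogeneous polynomials of degree $q$. Distance to a subvariety: for a subvariety $V$ of $\mathbb{P}^N_{\mathbb{C}_p}$, fix homogeneous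 polynomials $H_1,\dots,H_m\in\mathbb{C}_p[x_0,\dots,x_N]$ defining $V$ with $\|H_i\|=1$ (Gauss norm, i.e. maximum of the absolute values of the coefficients). For $y\in\mathbb{P}^N(\mathbb{C}_p)$ write $y=[y_0:\cdots:y_N]$ with $\max_i|y_i|=1$ and set $d(y,V):=\max_{1\le i\le m}|H_i(y_0,\dots,y_N)|$ (with $d(y,V)=0$ if $m=0$, i.e. if $V=\mathbb{P}^N$). *)

(* Defs.v *)
From HB Require Import structures.
(* The notations of mpoly clash with those of mathcomp-analysis. *)
From mathcomp Require Import -(notations) mpoly.
From mathcomp Require Import all_boot all_order all_algebra.
From mathcomp Require Import all_classical all_reals all_analysis.

Set Implicit Arguments.
Unset Strict Implicit.
Unset Printing Implicit Defensive.

Import Order.TTheory GRing.Theory Num.Theory.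
Import numFieldNormedType.Exports.

Local Open Scope classical_set_scope.
Local Open Scope ring_scope.
Local Open Scope quotient_scope.

Section ValuedFields.
Variable R : realType.

Definition nonarch_absval (K : fieldType) (nu : K -> R) : Prop :=
  [/\ forall x, 0 <= nu x,
      forall x, nu x = 0 <-> x = 0,
      forall x y, nu (x * y) = nu x * nu y &
      forall x y, nu (x + y) <= Num.max (nu x) (nu y)].

Definition absval_complete (K : fieldType) (nu : K -> R) : Prop :=
  forall u : nat -> K,
    (forall e : R, 0 < e -> exists n0 : nat, forall m n : nat,
       (n0 <= m)%N -> (n0 <= n)%N -> nu (u m - u n) < e) ->
    exists l : K, (fun n => nu (u n - l)) @ \oo --> (0 : R).

Definition is_completion (k K : fieldType) (nuk : k -> R) (nuK : K -> R)
    (f : {rmorphism k -> K}) : Prop :=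
  [/\ nonarch_absval nuK,
      absval_complete nuK,
      forall x, nuK (f x) = nuk x &
      forall (x : K) (e : R), 0 < e -> exists y : k, nuK (x - f y) < e].

Definition is_algebraic_closure (k L : fieldType) (f : {rmorphism k -> L}) :
    Prop :=
  GRing.closed_field_axiom L /\ forall x : L, algebraicOver f x.

Definition padic_absval (p : nat) (x : rat) : R :=
  if x == 0 then 0
  else p%:R ^ ((logn p `|denq x|%N)%:Z - (logn p `|numq x|%N)%:Z).

(* (Cp, nu) is a model of C_p: the completion of an algebraic closure L of
   Q_p, where L carries an absolute value extending the one of Q_p (the
   extension is unique), normalized by |p| = 1/p. *)
Definition is_Cp (p : nat) (Cp : fieldType) (nu : Cp -> R) : Prop :=
  exists (Qp L : fieldType) (nuQp : Qp -> R) (nuL : L -> R)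
         (f : {rmorphism rat -> Qp}) (g : {rmorphism Qp -> L})
         (h : {rmorphism L -> Cp}),
  [/\ is_completion (padic_absval p) nuQp f,
      is_algebraic_closure g,
      nonarch_absval nuL,
      forall x, nuL (g x) = nuQp x &
      is_completion nuL nu h].

Lemma nonarch_absval1 (K : fieldType) (nu : K -> R) :
  nonarch_absval nu -> nu 1 = 1.
Proof.
case=> _ nu0 nuM _.
have n1 : nu 1 != 0 by apply/eqP => /nu0/eqP; rewrite oner_eq0.
by apply: (mulfI n1); rewrite -nuM !mulr1.
Qed.

Lemma nonarch_absvalX (K : fieldType) (nu : K -> R) (x : K) (n : nat) :
  nonarch_absval nu -> nu (x ^+ n) = nu x ^+ n.
Proof.
move=> nuP; have [_ _ nuM _] := nuP; elim: n => [|n IHn].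
  by rewrite !expr0 nonarch_absval1.
by rewrite !exprS nuM IHn.
Qed.

Lemma nonarch_absval_sum (K : fieldType) (nu : K -> R) (I : eqType)
    (r : seq I) (E : I -> K) (c : R) :
  nonarch_absval nu -> 0 <= c -> {in r, forall i, nu (E i) <= c} ->
  nu (\sum_(i <- r) E i) <= c.
Proof.
move=> [_ nu0 _ nuD] c0 Ec; rewrite big_seq; elim/big_ind: _ => //.
  by have /nu0 -> : 0 = 0 :> K by [].
by move=> x y xc yc; rewrite (le_trans (nuD _ _)) // ge_max xc yc.
Qed.

End ValuedFields.

Section ProjectiveSpace.
Variables (K : fieldType) (N : nat).

Definition nzvec := {x : 'rV[K]_N.+1 | x != 0}.

(* Equality of the lines spanned by x and y; see ptP. *)
Definition same_line (x y : nzvec) : bool := (val x == val y)%MS.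

Fact same_line_refl : reflexive same_line.
Proof. by move=> x; rewrite /same_line submx_refl. Qed.

Fact same_line_sym : symmetric same_line.
Proof. by move=> x y; rewrite /same_line andbC. Qed.

Fact same_line_trans : transitive same_line.
Proof.
move=> y x z /andP[xy yx] /andP[yz zy].
by rewrite /same_line (submx_trans xy yz) (submx_trans zy yx).
Qed.

Canonical same_line_equiv :=
  EquivRel same_line same_line_refl same_line_sym same_line_trans.

Definition proj_space : Type := {eq_quot same_line_equiv}.
HB.instance Definition _ := Quotient.on proj_space.
HB.instance Definition _ := Choice.on proj_space.

Definition pt (x : nzvec) : proj_space := \pi_proj_space x.

Lemma ptP (x y : nzvec) :
  pt x = pt y <-> exists2 c : K, c != 0 & val x = c *: val y.
Proof.
have -> : pt x = pt y <-> same_line x y.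
  by split => [/eqmodP|xy]; [|apply/eqmodP].
split=> [/andP[/sub_rVP[c xcy] _]|[c c0 xcy]].
  exists c => //; apply: contraNneq (valP x) => c0.
  by rewrite /= xcy c0 scale0r.
rewrite /same_line xcy; apply/andP; split; apply/sub_rVP; first by exists c.
by exists c^-1; rewrite scalerA mulVf // scale1r.
Qed.

Definition hcoord (y : proj_space) : 'rV[K]_N.+1 := val (repr y).

Lemma hcoord_neq0 (y : proj_space) : hcoord y != 0.
Proof. exact: (valP (repr y)). Qed.

Lemma pt_repr (y : proj_space) : pt (repr y) = y.
Proof. exact: reprK. Qed.

Definition zero_locus (m : nat) (H : 'I_m -> mpoly N.+1 K) : set proj_space :=
  [set y | forall i, meval (hcoord y 0) (H i) = 0].

End ProjectiveSpace.

Section Distance.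
Variables (R : realType) (K : fieldType) (nu : K -> R) (N : nat).

Definition gauss_norm (P : mpoly N.+1 K) : R :=
  \big[Num.max/0]_(m <- msupp P) nu (mcoeff m P).

Definition defines (m : nat) (H : 'I_m -> mpoly N.+1 K) (V : set (proj_space K N)) :
    Prop :=
  [/\ forall i, exists d : nat, H i \is ishomog1 d mdeg,
      forall i, gauss_norm (H i) = 1 &
      V = zero_locus H].

(* Homogeneous coordinates of y divided by one of largest absolute value. *)
Definition normalized (y : proj_space K N) : 'rV[K]_N.+1 :=
  let x := hcoord y in
  (x 0 [arg max_(j > ord0) nu (x 0 j)]%O)^-1 *: x.

Definition dist_to (m : nat) (H : 'I_m -> mpoly N.+1 K) (y : proj_space K N) : R :=
  \big[Num.max/0]_(i < m) nu (meval (normalized y 0) (H i)).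

Lemma normalizedP (y : proj_space K N) : nonarch_absval nu ->
  [/\ exists2 x : nzvec K N, val x = normalized y & pt x = y,
      forall i, nu (normalized y 0 i) <= 1 &
      exists i, nu (normalized y 0 i) = 1].
Proof.
move=> nuP; have [nu_ge0 nu0 nuM _] := nuP; rewrite /normalized.
case: Order.TotalTheory.arg_maxP => //= j _ jmax; set x := hcoord y in jmax *.
have xj0 : x 0 j != 0.
  apply: contraNneq (hcoord_neq0 y) => xj0; apply/eqP/rowP => i.
  rewrite mxE; apply/nu0/le_anti; rewrite nu_ge0 andbT.
  by rewrite (le_trans (jmax i isT)) // xj0 (iffRL (nu0 0)).
have nxj : 0 < nu (x 0 j).
  by rewrite lt_neqAle nu_ge0 andbT eq_sym; apply/eqP => /nu0/eqP; apply/negP.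
have nuV : nu (x 0 j)^-1 = (nu (x 0 j))^-1.
  apply: (mulfI (lt0r_neq0 nxj)).
  by rewrite -nuM !divff ?nonarch_absval1 ?lt0r_neq0.
split=> [|i|]; last by exists j; rewrite mxE mulVf ?nonarch_absval1.
  have z0 : (x 0 j)^-1 *: x != 0 by rewrite scaler_eq0 invr_eq0 negb_or xj0 hcoord_neq0.
  exists (exist (fun v : 'rV[K]_N.+1 => v != 0) _ z0) => //; rewrite -[RHS]pt_repr; apply/ptP.
  by exists (x 0 j)^-1; rewrite ?invr_eq0.
by rewrite mxE nuM nuV mulrC ler_pdivrMr // mul1r jmax.
Qed.

Lemma meval_dhomog (d : nat) (P : mpoly N.+1 K) (c : K) (x : 'rV[K]_N.+1) :
  P \is ishomog1 d mdeg -> meval ((c *: x) 0) P = c ^+ d * meval (x 0) P.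
Proof.
move=> /dhomogP hP; rewrite !mevalE mulr_sumr !big_seq.
apply: eq_bigr => m mP; rewrite mulrCA; congr (_ * _).
have <- : mdeg m = d := hP m mP.
rewrite mdegE -prodrXr -big_split /=.
by apply: eq_bigr => i _; rewrite mxE exprMn.
Qed.

(* dist_to can be computed from any normalized homogeneous coordinates. *)
Lemma dist_toE (m : nat) (H : 'I_m -> mpoly N.+1 K) (x : nzvec K N) :
  nonarch_absval nu -> (forall i, exists d : nat, H i \is ishomog1 d mdeg) ->
  (forall i, nu (val x 0 i) <= 1) -> (exists i, nu (val x 0 i) = 1) ->
  dist_to H (pt x) = \big[Num.max/0]_(i < m) nu (meval (val x 0) (H i)).
Proof.
move=> nuP hH x1 [i xi1]; have [nu_ge0 nu0 nuM _] := nuP.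
have [[z zE /ptP[c c0 zx]] z1 [j zj1]] := normalizedP (pt x) nuP.
have nc1 : nu c = 1.
  apply: le_anti; apply/andP; split.
    by have := z1 i; rewrite -zE zx mxE nuM xi1 mulr1.
  by rewrite -zj1 -zE zx mxE nuM ler_piMr.
apply: eq_bigr => k _; rewrite -zE zx; have [d /meval_dhomog ->] := hH k.
by rewrite nuM nonarch_absvalX // nc1 expr1n mul1r.
Qed.

End Distance.

Section FrobeniusLift.
Variables (R : realType) (K : fieldType) (nu : K -> R) (N : nat).

Definition lift_vec (q : nat) (t : K) (P : 'I_N.+1 -> mpoly N.+1 K)
    (x : 'rV[K]_N.+1) : 'rV[K]_N.+1 :=
  \row_i (x 0 i ^+ q + t * meval (x 0) (P i)).

Lemma lift_vec_neq0 (q : nat) (t : K) (P : 'I_N.+1 -> mpoly N.+1 K)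
    (x : 'rV[K]_N.+1) : nonarch_absval nu -> nu t < 1 ->
  (forall i, P i \is ishomog1 q mdeg) ->
  (forall i m, nu (mcoeff m (P i)) <= 1) ->
  x != 0 -> lift_vec q t P x != 0.
Proof.
move=> nuP t1 hP P1 x0; have [nu_ge0 nu0 nuM nuD] := nuP.
have [[z zE /esym]] := normalizedP (pt (exist (fun v : 'rV[K]_N.+1 => v != 0) x x0)) nuP.
move=> /ptP[c c0 /= xE] z1 [j zj1].
move: z1 zj1; rewrite -zE => z1 zj1.
have -> : lift_vec q t P x = c ^+ q *: lift_vec q t P (val z).
  by apply/rowP => i; rewrite !mxE xE (meval_dhomog _ _ (hP i)) mxE exprMn mulrDr mulrCA.
rewrite scaler_eq0 expf_eq0 (negbTE c0) andbF /=.
apply/eqP => /rowP/(_ j); rewrite !mxE => /eqP; rewrite addr_eq0 => /eqP zq.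
have e1 : nu (val z 0 j ^+ q) = 1 by rewrite nonarch_absvalX // zj1 expr1n.
have nuN1 : nu (-1) = 1.
  apply/eqP; rewrite -(@eqrXn2 _ 2) ?nu_ge0 //; apply/eqP.
  by rewrite -nonarch_absvalX // sqrrN !expr1n nonarch_absval1.
have : nu t * nu (meval (val z 0) (P j)) = 1.
  by rewrite -e1 zq -[in RHS]mulN1r !nuM nuN1 mul1r.
have /(ler_piMr (nu_ge0 t)) tP : nu (meval (val z 0) (P j)) <= 1.
  rewrite mevalE; apply: nonarch_absval_sum => // m _.
  rewrite nuM mulr_ile1 ?P1 //.
  elim/big_ind: _ => [|u v u1 v1|i _].
  - by rewrite nonarch_absval1.
  - by rewrite nuM mulr_ile1.
  - by rewrite nonarch_absvalX // exprn_ile1.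
by move=> e; move: tP; rewrite e leNgt t1.
Qed.

Definition is_frobenius_lift (p : nat) (F : proj_space K N -> proj_space K N) : Prop :=
  exists (s : nat) (t : K) (P : 'I_N.+1 -> mpoly N.+1 K),
  [/\ (1 <= s)%N,
      nu t < 1,
      forall i, P i \is ishomog1 (p ^ s) mdeg,
      forall i m, nu (mcoeff m (P i)) <= 1 &
      forall x : nzvec K N, exists2 y : nzvec K N,
        val y = lift_vec (p ^ s) t P (val x) & F (pt x) = pt y].

End FrobeniusLift.

(* Main.v *)
(** In homogeneous coordinates [x_n] of [b_n] with a fixed coordinate equal to 1,
    [x_n] is congruent to [x_(n+1) ^ q] modulo [r = max (|p|, |p'|)]; hence
    [z_n = lim_k x_(n+k) ^ (q ^ k)] exists and [z_n = z_(n+1) ^ q].  As the lift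
    [Phi] of [F] contracts differences by [r], for homogeneous [H] the number
    [|H(x_n)| = |(H o Phi^j)(x_(n+j))|] equals [|(H o Phi^j)(z_(n+j))|] up to
    [r ^ (j+1)].  So it suffices to study [|G(z_n)|] for integral polynomials [G].

    The polynomials [G] with [sup_k |G(z_(sk))| < 1] form an ideal containing the
    polynomials with topologically nilpotent coefficients.  The residue field is
    algebraic over [F_p], and polynomials over it are noetherian, so these ideals
    are all contained in the one of a single period [s].  For that [s], either
    [G] belongs to the ideal or [|G(z_(sk))|] tends to 1, because [G(z_n)] is, up
    to a small error, the [q ^ S]-th power of [G(z_(n+S))].

    Approximate the coefficients of [G] by elements of a finite extension of
    [Q_p], with uniformizer [pi].  In the first case [G(z_n) = pi G_1(z_(n+k))] up
    to an arbitrarily small error; iterating, if [|G(z_(sk))| <= |pi| ^ l] for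
    infinitely many [k], then for all [k].  Hence if [H(x_n)] comes arbitrarily
    close to 0 on a residue class modulo [s], it vanishes on that whole class;
    this gives both conclusions, [s] iterates of [V] being enough. *)
Require Import Defs.
From mathcomp Require Import -(notations) mpoly.
From mathcomp Require Import all_boot all_order all_algebra.
From mathcomp Require Import all_classical all_reals all_analysis.
From mathcomp Require Import separable.
From mathcomp Require Import ring lra.

Import Order.TTheory GRing.Theory Num.Theory.
Import numFieldNormedType.Exports.

Set Implicit Arguments.
Unset Strict Implicit.
Unset Printing Implicit Defensive.

Local Open Scope classical_set_scope.
Local Open Scope ring_scope.

(** * Frobenius congruences in subrings *)

Section Subring.
Variables (A : comNzRingType) (D : A -> Prop).

(** A plain predicate, so that the same congruences apply to the valuation ring, to its discrete
    subrings and to polynomials over either. *)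
Definition is_subring : Prop :=
  [/\ D 1, forall x y, D x -> D y -> D (x - y) &
      forall x y, D x -> D y -> D (x * y)].

Hypothesis DP : is_subring.

Lemma subring1 : D 1. Proof. by case: DP. Qed.
Lemma subringB x y : D x -> D y -> D (x - y). Proof. by case: DP => _ + _; apply. Qed.
Lemma subringM x y : D x -> D y -> D (x * y). Proof. by case: DP => _ _; apply. Qed.
Lemma subring0 : D 0. Proof. by rewrite -(subrr 1); apply: subringB; exact: subring1. Qed.
Lemma subringN x : D x -> D (- x).
Proof. by move=> Dx; rewrite -sub0r; apply: subringB => //; exact: subring0. Qed.
Lemma subringD x y : D x -> D y -> D (x + y).
Proof. by move=> Dx Dy; rewrite -[y]opprK; apply/subringB/subringN. Qed.
Lemma subringX x n : D x -> D (x ^+ n).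
Proof.
by move=> Dx; elim: n => [|n IHn]; rewrite ?exprS; [exact: subring1|exact: subringM].
Qed.
Lemma subringMn x n : D x -> D (x *+ n).
Proof.
by move=> Dx; elim: n => [|n IHn]; rewrite ?mulrS; [exact: subring0|exact: subringD].
Qed.
Lemma subring_nat n : D n%:R. Proof. exact/subringMn/subring1. Qed.
Lemma subring_sum (I : Type) (r : seq I) (P : pred I) (u : I -> A) :
  (forall i, P i -> D (u i)) -> D (\sum_(i <- r | P i) u i).
Proof.
move=> Du; elim/big_ind: _ => //; first exact: subring0.
by move=> x y; exact: subringD.
Qed.

Variables (p : nat) (p_prime : prime p).

(** The inner binomial coefficients are divisible by [p] and the quotients are natural numbers, so
    the remainder [h] stays in [D]. *)
Lemma frobenius_addM (u v : A) : D u -> D v ->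
  exists2 h, D h & (u + v) ^+ p = u ^+ p + v ^+ p + p%:R * h.
Proof.
move=> Du Dv; rewrite exprDn; case: p p_prime => // n p_pr.
rewrite big_ord_recr big_ord_recl /= subn0 subnn expr0 mulr1 bin0 binn mul1r !mulr1n.
have nE (i : 'I_n) : 'C(n.+1, i.+1) = (n.+1 * ('C(n.+1, i.+1) %/ n.+1))%N.
  by apply/esym; rewrite mulnC divnK // prime_dvd_bin //= ltnS ltn_ord.
exists (\sum_(i < n) (u ^+ (n.+1 - i.+1) * v ^+ i.+1) *+ ('C(n.+1, i.+1) %/ n.+1)).
  by apply: subring_sum => i _; apply/subringMn/subringM; exact: subringX.
rewrite addrAC; congr (_ + _ + _); rewrite mulr_sumr; apply: eq_bigr => i _.
by rewrite [in LHS]nE mulrnA mulr_natl -mulrnA mulnC mulrnA.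
Qed.

Lemma frobenius_expD k (u v : A) : D u -> D v ->
  exists2 h, D h & (u + v) ^+ (p ^ k) = u ^+ (p ^ k) + v ^+ (p ^ k) + p%:R * h.
Proof.
move=> Du Dv; elim: k => [|k [h Dh IHk]].
  by exists 0; rewrite ?expn0 ?expr1 ?mulr0 ?addr0 //; exact: subring0.
have Dp := subring_nat p.
rewrite expnSr !exprM IHk.
set a := u ^+ _; set b := v ^+ _.
have Da : D a by exact: subringX.
have Db : D b by exact: subringX.
have [h1 Dh1 ->] := frobenius_addM (subringD Da Db) (subringM Dp Dh).
have [h2 Dh2 ->] := frobenius_addM Da Db.
have p0 : (0 < p)%N := prime_gt0 p_prime.
(* The last term is [(p h) ^ p] divided by [p]. *)
exists (h2 + h1 + p%:R ^+ p.-1 * h ^+ p).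
  by do !apply: subringD => //; apply: subringM; exact: subringX.
by rewrite exprMn -{5}(prednK p0) exprS; ring.
Qed.

Lemma frobenius_sum k (I : eqType) (r : seq I) (u : I -> A) :
  {in r, forall i, D (u i)} ->
  exists2 h, D h &
    (\sum_(i <- r) u i) ^+ (p ^ k) = \sum_(i <- r) u i ^+ (p ^ k) + p%:R * h.
Proof.
elim: r => [|i r IHr] Du.
  exists 0; first exact: subring0.
  by rewrite !big_nil mulr0 addr0 expr0n expn_eq0 -leqn0 leqNgt prime_gt0.
have [j rj|h Dh hE] := IHr; first by apply: Du; rewrite inE rj orbT.
rewrite !big_cons.
have Di : D (u i) by apply: Du; rewrite inE eqxx.
have Ds : D (\sum_(j <- r) u j).
  by rewrite big_seq; apply: subring_sum => j rj; apply: Du; rewrite inE rj orbT.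
have [h1 Dh1 ->] := frobenius_expD k Di Ds.
by exists (h + h1); [exact: subringD|rewrite hE; ring].
Qed.

End Subring.

(** * Nonarchimedean absolute values *)

Section NonarchimedeanField.
Variables (R : realType) (K : fieldType) (nu : K -> R).
Hypothesis nuP : nonarch_absval nu.

Lemma absval_ge0 x : 0 <= nu x. Proof. by case: nuP. Qed.
Lemma absval_eq0 x : (nu x == 0) = (x == 0).
Proof. by case: nuP => _ nu0 _ _; apply/eqP/eqP => /nu0. Qed.
Lemma absval0 : nu 0 = 0. Proof. by apply/eqP; rewrite absval_eq0. Qed.
Lemma absval_gt0 x : (0 < nu x) = (x != 0).
Proof. by rewrite lt_neqAle absval_ge0 andbT eq_sym absval_eq0. Qed.
Lemma absvalM x y : nu (x * y) = nu x * nu y. Proof. by case: nuP. Qed.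
Lemma absval1 : nu 1 = 1. Proof. exact: nonarch_absval1. Qed.
Lemma absvalX x n : nu (x ^+ n) = nu x ^+ n. Proof. exact: nonarch_absvalX. Qed.
Lemma absvalV x : nu x^-1 = (nu x)^-1.
Proof.
have [->|x0] := eqVneq x 0; first by rewrite invr0 absval0 invr0.
have nx : nu x != 0 by rewrite absval_eq0.
by apply: (mulfI nx); rewrite -absvalM !divff // absval1.
Qed.
Lemma absvalN x : nu (- x) = nu x.
Proof.
have nuN1 : nu (-1) = 1.
  apply/eqP; rewrite -(@eqrXn2 _ 2) ?absval_ge0 //; apply/eqP.
  by rewrite -absvalX sqrrN !expr1n absval1.
by rewrite -mulN1r absvalM nuN1 mul1r.
Qed.
Lemma absvalBC x y : nu (x - y) = nu (y - x). Proof. by rewrite -absvalN opprB. Qed.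

Lemma absvalD_le x y c : nu x <= c -> nu y <= c -> nu (x + y) <= c.
Proof.
by case: nuP => _ _ _ nuD xc yc; rewrite (le_trans (nuD _ _)) // ge_max xc yc.
Qed.
Lemma absvalB_le x y c : nu x <= c -> nu y <= c -> nu (x - y) <= c.
Proof. by move=> xc yc; rewrite absvalD_le ?absvalN. Qed.
Lemma absvalD_lt x y c : nu x < c -> nu y < c -> nu (x + y) < c.
Proof.
by case: nuP => _ _ _ nuD xc yc; rewrite (le_lt_trans (nuD _ _)) // gt_max xc yc.
Qed.
Lemma absvalB_lt x y c : nu x < c -> nu y < c -> nu (x - y) < c.
Proof. by move=> xc yc; rewrite absvalD_lt ?absvalN. Qed.
Lemma absval_le_trans y x z c : nu (x - y) <= c -> nu (y - z) <= c -> nu (x - z) <= c.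
Proof. by move=> xy yz; rewrite -[x](subrK y) -addrA absvalD_le. Qed.
Lemma absval_lt_trans y x z c : nu (x - y) < c -> nu (y - z) < c -> nu (x - z) < c.
Proof. by move=> xy yz; rewrite -[x](subrK y) -addrA absvalD_lt. Qed.
Lemma absval_le_close y x c : nu (x - y) <= c -> nu y <= c -> nu x <= c.
Proof. by move=> xy yc; rewrite -[x](subrK y) absvalD_le. Qed.
Lemma absval_lt_close y x c : nu (x - y) < c -> nu y < c -> nu x < c.
Proof. by move=> xy yc; rewrite -[x](subrK y) absvalD_lt. Qed.
Lemma absval_eq x y : nu (x - y) < nu x -> nu y = nu x.
Proof.
move=> xy; apply/le_anti/andP; split.
  by rewrite (@absval_le_close x) // absvalBC ltW.
by rewrite leNgt; apply/negP => yx; have := absval_lt_close xy yx; rewrite ltxx.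
Qed.

Lemma absval_sum_le (I : eqType) (r : seq I) (E : I -> K) (c : R) :
  0 <= c -> {in r, forall i, nu (E i) <= c} -> nu (\sum_(i <- r) E i) <= c.
Proof. exact: nonarch_absval_sum. Qed.

Lemma absval_sum_lt (I : eqType) (r : seq I) (E : I -> K) (c : R) :
  0 < c -> {in r, forall i, nu (E i) < c} -> nu (\sum_(i <- r) E i) < c.
Proof.
move=> c0 Ec; rewrite big_seq; elim/big_ind: _ => //; first by rewrite absval0.
by move=> x y; exact: absvalD_lt.
Qed.

Definition valring (x : K) : Prop := nu x <= 1.

Lemma valring_subring : is_subring valring.
Proof.
split; rewrite /valring ?absval1 // => x y x1 y1; first exact: absvalB_le.
by rewrite absvalM mulr_ile1 ?absval_ge0.
Qed.

Lemma absval_nat n : nu n%:R <= 1. Proof. exact/(subring_nat valring_subring). Qed.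
Lemma absvalM_le x y c : valring x -> nu y <= c -> nu (x * y) <= c.
Proof.
by move=> x1 yc; rewrite absvalM (le_trans _ yc) // ler_piMl ?absval_ge0.
Qed.
Lemma absvalM_lt x y c : valring x -> nu y < c -> nu (x * y) < c.
Proof. by move=> x1 yc; rewrite (le_lt_trans _ yc) // absvalM_le. Qed.

Lemma absval_subM x x' y y' c : valring x' -> valring y ->
  nu (x - x') <= c -> nu (y - y') <= c -> nu (x * y - x' * y') <= c.
Proof.
move=> x1 y1 xc yc; apply: (@absval_le_trans (x' * y)).
  by rewrite -mulrBl mulrC absvalM_le.
by rewrite -mulrBr absvalM_le.
Qed.

Lemma absval_subX x y n c : 0 <= c -> valring x -> valring y ->
  nu (x - y) <= c -> nu (x ^+ n - y ^+ n) <= c.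
Proof.
move=> c0 x1 y1 xy; elim: n => [|n IHn]; first by rewrite !expr0 subrr absval0.
by rewrite !exprS absval_subM //; exact: (subringX valring_subring).
Qed.

Lemma absval_subX_lt x y n c : valring x -> valring y ->
  nu (x - y) < c -> nu (x ^+ n - y ^+ n) < c.
Proof.
by move=> x1 y1; apply: le_lt_trans; apply: absval_subX => //; exact: absval_ge0.
Qed.

(** Factor out [x - y]: the cofactor is a sum of [p] terms each within [c] of [y ^ (p - 1)], hence
    it is [p y ^ (p - 1)] up to [c], of absolute value at most [r]. *)
Lemma absval_subX_prime (p : nat) x y c r : (0 < p)%N ->
  valring x -> valring y -> nu p%:R <= r -> c <= r ->
  nu (x - y) <= c -> nu (x ^+ p - y ^+ p) <= r * c.
Proof.
move=> p0 x1 y1 pr cr xy; have c0 : 0 <= c := le_trans (absval_ge0 _) xy.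
have r0 : 0 <= r := le_trans c0 cr.
rewrite subrXX absvalM mulrC ler_pM ?absval_ge0 //.
apply: (@absval_le_close (p%:R * y ^+ p.-1)); last first.
  by rewrite mulrC absvalM_le //; exact: (subringX valring_subring).
have -> : p%:R * y ^+ p.-1 = \sum_(i < p) y ^+ (p.-1 - i) * y ^+ i.
  rewrite (eq_bigr (fun=> y ^+ p.-1)) => [|i _].
    by rewrite sumr_const card_ord mulr_natl.
  by rewrite -exprD subnK // -ltnS prednK.
rewrite -sumrB (le_trans _ cr) // absval_sum_le // => i _.
rewrite -mulrBl mulrC absvalM_le ?absval_subX //.
exact: (subringX valring_subring).
Qed.

Lemma absval_subX_primeX (p : nat) k x y c r : (0 < p)%N ->
  valring x -> valring y -> nu p%:R <= r -> r <= 1 -> c <= r ->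
  nu (x - y) <= c -> nu (x ^+ (p ^ k) - y ^+ (p ^ k)) <= r ^+ k * c.
Proof.
move=> p0 x1 y1 pr r1 cr xy.
have c0 : 0 <= c := le_trans (absval_ge0 _) xy.
have r0 : 0 <= r := le_trans c0 cr.
elim: k => [|k IHk]; first by rewrite expn0 !expr1 expr0 mul1r.
rewrite expnSr !exprM exprS -mulrA absval_subX_prime //.
- exact: (subringX valring_subring).
- exact: (subringX valring_subring).
- by rewrite (le_trans _ cr) // ler_piMl // exprn_ile1.
Qed.

Lemma absval_fixX x n k : valring x ->
  nu (x ^+ n - x) < 1 -> nu (x ^+ (n ^ k) - x) < 1.
Proof.
move=> x1 xn; elim: k => [|k IHk]; first by rewrite expn0 expr1 subrr absval0.
apply: (absval_lt_trans _ xn); rewrite expnS mulnC exprM.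
by apply: absval_subX_lt => //; exact: (subringX valring_subring).
Qed.

(** A term strictly larger than all the others could not be cancelled, so the maximal absolute value
    is attained twice. *)
Lemma absval_sum_eq (n : nat) (t : 'I_n -> K) :
  \sum_(i < n) t i = 0 -> (exists i, t i != 0) ->
  exists i j : 'I_n, [/\ (i < j)%N, t i != 0 & nu (t i) = nu (t j)].
Proof.
move=> t0 [i0 ti0].
case: (@Order.TotalTheory.arg_maxP _ _ _ i0 xpredT (nu \o t) isT) => i _ /= imax.
have ti : t i != 0.
  by rewrite -absval_gt0 (lt_le_trans _ (imax i0 isT)) ?absval_gt0.
suff [j ji tj] : exists2 j, j != i & nu (t j) = nu (t i).
  move: ji; rewrite neq_ltn => /orP[]; [exists j, i|exists i, j]; split=> //.
  by rewrite -absval_gt0 tj absval_gt0.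
apply: contrapT => no; move: t0; rewrite (bigD1 i) //= => /eqP.
rewrite addr_eq0 => /eqP tiE; have : nu (t i) < nu (t i); last by rewrite ltxx.
rewrite {1}tiE absvalN; elim/big_ind: _ => [|x y|j ji]; first by rewrite absval0 absval_gt0.
  exact: absvalD_lt.
by rewrite lt_neqAle imax ?andbT //; apply/eqP => tj; apply: no; exists j.
Qed.

End NonarchimedeanField.

Local Notation "p @_ m" := (mpoly.mcoeff m p) (at level 3).

(** * Polynomials over the valuation ring *)

Section PolynomialsOver.
Variables (K : fieldType) (N : nat) (D : K -> Prop).
Hypothesis DP : is_subring D.
Implicit Types (G : mpoly N K) (m : multinom N).

Definition poly_over G : Prop := forall m, D (G@_m).

Lemma poly_overX m : poly_over (mpolyX K m).
Proof. by move=> m'; rewrite mcoeffX; exact: subring_nat. Qed.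

Lemma poly_overZ c G : D c -> poly_over G -> poly_over (c *: G).
Proof. by move=> Dc DG m; rewrite mcoeffZ; exact: subringM. Qed.

Lemma poly_over_subring : is_subring poly_over.
Proof.
split=> [m|x y Dx Dy m|x y Dx Dy m].
- by rewrite mcoeff1; exact: subring_nat.
- by rewrite mcoeffB; exact: subringB.
- by rewrite mcoeffM; apply: subring_sum => // k _; exact: subringM.
Qed.

(** For [Q] a power of [p] and [G] integral, [G ^ Q] is congruent modulo [p] to this polynomial
    evaluated at the [Q]-th powers of the variables. *)
Definition twist (Q : nat) G : mpoly N K :=
  \sum_(m <- msupp G) (G@_m) ^+ Q *: mpolyX K m.

Lemma mcoeff_sumX (r : seq (multinom N)) (c : multinom N -> K) m : uniq r ->
  (\sum_(m' <- r) c m' *: mpolyX K m')@_m = if m \in r then c m else 0.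
Proof.
move=> ur; rewrite raddf_sum /=; case: ifPn => mr.
  rewrite (bigD1_seq m) //= mcoeffZ mcoeffX eqxx mulr1 big1 ?addr0 // => m' /negPf m'm.
  by rewrite mcoeffZ mcoeffX m'm mulr0.
rewrite big_seq big1 // => m' m'r; rewrite mcoeffZ mcoeffX.
by have [e|_] := eqVneq m' m; [rewrite -e m'r in mr|rewrite mulr0].
Qed.

Lemma mcoeff_twist Q G m : (0 < Q)%N -> (twist Q G)@_m = (G@_m) ^+ Q.
Proof.
move=> Q0; rewrite mcoeff_sumX ?msupp_uniq // mcoeff_msupp.
by case: eqP => //= ->; rewrite expr0n gtn_eqF.
Qed.

Lemma meval_twist Q G v :
  meval v (twist Q G) = \sum_(m <- msupp G) (G@_m) ^+ Q * \prod_i v i ^+ m i.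
Proof.
by rewrite raddf_sum; apply: eq_bigr => m _; rewrite /= mevalZ mevalX.
Qed.

Lemma poly_over_comp (lq : N.-tuple (mpoly N K)) G :
  poly_over G -> (forall i, poly_over (tnth lq i)) -> poly_over (comp_mpoly lq G).
Proof.
move=> DG Dlq; rewrite comp_mpolyEX; apply: (subring_sum poly_over_subring) => m _.
rewrite comp_mpolyX; apply: poly_overZ; first exact: DG.
elim/big_ind: _ => [|x y|i _]; [|exact: (subringM poly_over_subring)|].
  exact: (subring1 poly_over_subring).
exact: (subringX poly_over_subring).
Qed.

Lemma meval_comp (lq : N.-tuple (mpoly N K)) G v :
  meval v (comp_mpoly lq G) = meval (fun i => meval v (tnth lq i)) G.
Proof.
rewrite comp_mpolyEX raddf_sum mevalE; apply: eq_bigr => m _ /=.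
by rewrite mevalZ comp_mpolyX rmorph_prod; under eq_bigr do rewrite rmorphXn.
Qed.

(** The congruence is taken in the polynomial ring before evaluating, so that one [h] over [D]
    serves every point [v]. *)
Lemma frobenius_meval (p : nat) k G : prime p -> poly_over G ->
  exists2 h, poly_over h & forall v, meval v G ^+ (p ^ k) =
    meval (fun i => v i ^+ (p ^ k)) (twist (p ^ k) G) + p%:R * meval v h.
Proof.
move=> p_pr DG.
have [m _|h Dh hE] := @frobenius_sum _ _ poly_over_subring p p_pr k _ (msupp G)
  (fun m => G@_m *: mpolyX K m).
  by apply: poly_overZ => //; exact: poly_overX.
exists h => // v; rewrite {1}[G]mpolyE -rmorphXn /= hE mevalD mevalM.
rewrite rmorph_nat; congr (_ + _); rewrite meval_twist raddf_sum.
apply: eq_bigr => m _ /=; rewrite rmorphXn /= mevalZ mevalX exprMn -prodrXl.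
by congr (_ * _); apply: eq_bigr => i _; rewrite exprAC.
Qed.

End PolynomialsOver.

Section PolynomialValues.
Variables (R : realType) (K : fieldType) (nu : K -> R) (N : nat).
Hypothesis nuP : nonarch_absval nu.
Implicit Types (G : mpoly N K) (v w : 'I_N -> K).

Definition valring_point v : Prop := forall i, nu (v i) <= 1.

Lemma absval_monom v (m : multinom N) :
  valring_point v -> nu (\prod_i v i ^+ m i) <= 1.
Proof.
move=> v1; elim/big_ind: _ => [|x y x1 y1|i _].
- by rewrite absval1.
- exact: absvalM_le.
- exact/(subringX (valring_subring nuP))/v1.
Qed.

Lemma absval_meval_le G v c : 0 <= c -> valring_point v ->
  (forall m, nu (G@_m) <= c) -> nu (meval v G) <= c.
Proof.
move=> c0 v1 Gc; rewrite mevalE absval_sum_le // => m _.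
by rewrite mulrC absvalM_le // /valring absval_monom.
Qed.

Lemma absval_meval_sub G v w c : 0 <= c -> valring_point v -> valring_point w ->
  poly_over (valring nu) G ->
  (forall i, nu (v i - w i) <= c) -> nu (meval v G - meval w G) <= c.
Proof.
move=> c0 v1 w1 G1 vw; rewrite !mevalE -sumrB absval_sum_le // => m _.
rewrite -mulrBr; apply: (absvalM_le nuP) (G1 m) _.
pose P x y := [/\ valring nu x, valring nu y & nu (x - y) <= c].
suff [] : P (\prod_i v i ^+ m i) (\prod_i w i ^+ m i) by [].
have S := valring_subring nuP.
elim/big_ind2: _ => [|x x' y y' [x1 x'1 xx'] [y1 y'1 yy']|i _].
- by split; [exact: subring1|exact: subring1|rewrite subrr absval0].
- split; [exact: subringM|exact: subringM|exact: absval_subM].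
- split; [exact/(subringX S)/v1|exact/(subringX S)/w1|].
  by apply: absval_subX => //; [exact: v1|exact: w1].
Qed.

Lemma absval_meval_frobenius (p k : nat) G v : prime p ->
  poly_over (valring nu) G -> valring_point v ->
  nu (meval v G ^+ (p ^ k) -
      meval (fun i => v i ^+ (p ^ k)) (twist (p ^ k) G)) <= nu p%:R.
Proof.
move=> p_pr G1 v1.
have [h h1 ->] := frobenius_meval (valring_subring nuP) k p_pr G1.
rewrite addrAC subrr add0r mulrC absvalM_le //; exact: absval_meval_le.
Qed.

End PolynomialValues.

(** * Chains of ideals over the residue field *)

Section Dickson.
Variable N : nat.

Lemma monotone_subsequence (u : nat -> nat) :
  exists2 phi : nat -> nat, {homo phi : i j / (i < j)%N} &
    {homo (fun i => u (phi i)) : i j / (i <= j)%N}.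
Proof.
(* Each new index is taken to minimize [u] on the whole remaining tail. *)
have argmin a : exists i, (a <= i)%N /\ forall j, (a <= j)%N -> (u i <= u j)%N.
  have ex : exists v, `[< exists2 i, (a <= i)%N & u i = v >].
    by exists (u a); apply/asboolP; exists a.
  case: (ex_minnP ex) => v /asboolP[i ai <-] vmin.
  by exists i; split=> // j aj; apply: vmin; apply/asboolP; exists j.
have [g gP] := choice argmin.
pose phi k := iter k (fun a => g a.+1) (g 0).
have phiS k : phi k.+1 = g (phi k).+1 by [].
have phi_min k j : (phi k <= j)%N -> (u (phi k) <= u j)%N.
  case: k => [|k] kj; first by apply: (gP 0).2.
  apply: (gP _).2; apply: leq_trans kj; rewrite phiS.
  exact: leq_trans (gP _).1.
have phi_lt k : (phi k < phi k.+1)%N by rewrite phiS; exact: (gP _).1.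
have phi_homo : {homo phi : i j / (i < j)%N} by apply: homo_ltn => //; exact: ltn_trans.
exists phi => // i j; rewrite leq_eqVlt => /predU1P[-> //|ij].
by apply: phi_min; rewrite ltnW ?phi_homo.
Qed.

Lemma monotone_subsequence_multi (f : nat -> multinom N) :
  exists2 phi : nat -> nat, {homo phi : i j / (i < j)%N} &
    forall l : 'I_N, {homo (fun i => f (phi i) l) : i j / (i <= j)%N}.
Proof.
suff [phi h1 h2] : exists2 phi : nat -> nat, {homo phi : i j / (i < j)%N} &
    forall l : 'I_N, l \in enum 'I_N ->
      {homo (fun i => f (phi i) l) : i j / (i <= j)%N}.
  by exists phi => // l; apply: h2; rewrite mem_enum.
elim: (enum 'I_N) => [|l s [phi phi_lt phi_le]]; first by exists id.
have [psi psi_lt psi_le] := monotone_subsequence (fun i => f (phi i) l).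
exists (phi \o psi) => [i j ij|l']; first exact/phi_lt/psi_lt.
rewrite inE => /predU1P[->|l's] i j ij; first exact: psi_le.
apply: (phi_le _ l's); move: ij; rewrite leq_eqVlt => /predU1P[-> //|ij].
exact/ltnW/psi_lt.
Qed.

Lemma dickson (f : nat -> multinom N) : exists i j, (i < j)%N /\ mpoly.lem (f i) (f j).
Proof.
have [phi phi_lt phi_le] := monotone_subsequence_multi f.
by exists (phi 0), (phi 1); split; [exact: phi_lt|apply/mnm_lepP => l; exact: phi_le].
Qed.

(** If the chain of up-closed sets were never stationary, picking at each stage an exponent of a
    later set missing from the current one would contradict Dickson's lemma. *)
Lemma dickson_chain (L : nat -> multinom N -> Prop) :
  (forall i j m, (i <= j)%N -> L i m -> L j m) ->
  (forall i m m', mpoly.lem m m' -> L i m -> L i m') ->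
  exists i0, forall i m, L i m -> L i0 m.
Proof.
move=> Lmono Lup; apply: contrapT => nostop.
have next i : exists jm : nat * multinom N, [/\ (i < jm.1)%N, L jm.1 jm.2 & ~ L i jm.2].
  apply: contrapT => no; apply: nostop; exists i => j m Ljm.
  apply: contrapT => nL; apply: no; exists (j, m); split=> //=.
  by rewrite ltnNge; apply/negP => ji; apply: nL; exact: Lmono Ljm.
have [g gP] := choice next.
pose a k := iter k (fun i => (g i).1) 0.
have a_lt : {homo a : i j / (i < j)%N}.
  by apply: homo_ltn => [|k]; [exact: ltn_trans|have [] := gP (a k)].
have [k [l [kl klm]]] := dickson (fun k => (g (a k)).2).
have [_ Lk _] := gP (a k); have [_ _ nLl] := gP (a l).
apply: nLl; apply: Lup klm _; apply: Lmono Lk.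
move: kl; rewrite leq_eqVlt => /predU1P[<- //|kl].
by rewrite -[(g (a k)).1]/(a k.+1) ltnW // a_lt.
Qed.

End Dickson.

Section NoetherianModuloMaximalIdeal.
Variables (R : realType) (K : fieldType) (nu : K -> R) (N : nat).
Hypothesis nuP : nonarch_absval nu.
Implicit Types (G : mpoly N K) (m : multinom N) (U : mpoly N K -> Prop).

(* [U] is an ideal of the polynomial ring over the valuation ring, containing
   the extension of the maximal ideal. *)
Definition residual_ideal U : Prop :=
  [/\ forall G, (forall m, nu (G@_m) < 1) -> U G,
      forall G, U G -> poly_over (valring nu) G,
      forall G G', U G -> U G' -> U (G - G') &
      forall G c m, valring nu c -> U G -> U (c *: (G * mpolyX K m))].

(** For integral [G], this is the leading exponent of the reduction modulo the maximal ideal. *)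
Definition residual_lead G m : Prop :=
  nu (G@_m) = 1 /\ forall m', (m < m')%O -> nu (G@_m') < 1.

Lemma residual_lead_ex G : poly_over (valring nu) G ->
  (forall m, nu (G@_m) < 1) \/ exists m, residual_lead G m.
Proof.
move=> G1; have [small|/existsNP[m0 m0P]] := pselect (forall m, nu (G@_m) < 1).
  by left.
right; have unit m : nu (G@_m) < 1 \/ nu (G@_m) = 1.
  by have := G1 m; rewrite /valring le_eqVlt => /predU1P[]; [right|left].
pose s := [seq m <- msupp G | nu (G@_m) == 1].
have sP m : nu (G@_m) = 1 -> m \in s.
  move=> Gm; rewrite mem_filter Gm eqxx /= mcoeff_msupp -(absval_eq0 nuP) Gm.
  exact: oner_neq0.
have m0s : m0 \in s by apply: sP; case: (unit m0).
have us : uniq s by rewrite filter_uniq ?msupp_uniq.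
(* [T] keeps only the coefficients of absolute value 1, so its leading exponent is the residual
   one. *)
pose T := \sum_(m <- s) G@_m *: mpolyX K m.
have TE m : T@_m = if m \in s then G@_m else 0 := mcoeff_sumX _ _ us.
have sE m : m \in s -> nu (G@_m) = 1 by rewrite mem_filter => /andP[/eqP].
have inT m : m \in s -> m \in msupp T.
  by move=> ms; rewrite mcoeff_msupp TE ms; move: ms; rewrite mem_filter mcoeff_msupp => /andP[].
have T0 : T != 0.
  by apply/eqP => T0; have := inT _ m0s; rewrite T0 mcoeff_msupp mcoeff0 eqxx.
exists (mlead T); split=> [|m mT].
  by apply: sE; have := mlead_supp T0; rewrite mcoeff_msupp TE; case: ifP => // _; rewrite eqxx.
case: (unit m) => // /sP/inT /msupp_le_mlead.
by rewrite leNgt mT.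
Qed.

(** Hilbert's basis theorem by leading terms, carried out on lifts: Dickson's lemma makes the sets
    of leading exponents stationary at [i0], and elements of [U i0] then reduce any element of a
    later [U i] to one with small coefficients. *)
Lemma residual_ideal_noetherian (U : nat -> mpoly N K -> Prop) :
  (forall i, residual_ideal (U i)) ->
  (forall i j G, (i <= j)%N -> U i G -> U j G) ->
  exists i0, forall i G, U i G -> U i0 G.
Proof.
move=> idU Umono.
pose L i m := exists2 G, U i G & residual_lead G m.
have [i j m ij [G UG Gm]|i m m' /submK mm' [G UG [Gm Glt]]|i0 i0P] :=
  @dickson_chain _ L.
- by exists G => //; exact: Umono UG.
- have [_ _ _ UM] := idU i.
  (* Multiplying by the monomial of exponent [m' - m] shifts the leading exponent from [m] to
     [m']. *)
  have XE k : (1 *: (G * mpolyX K (mnm_sub m' m)))@_(mnm_add k (mnm_sub m' m)) = G@_k.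
    by rewrite scale1r addmC mcoeffMX.
  exists (1 *: (G * mpolyX K (mnm_sub m' m))).
    by apply: UM => //; rewrite /valring absval1.
  split=> [|k mk]; first by have := XE m; rewrite addmC mm' => ->.
  have [le|nle] := boolP (mpoly.lem (mnm_sub m' m) k).
    rewrite -(submK le) XE; apply: Glt.
    by rewrite -(ltmc_add2l _ _ (mnm_sub m' m)) (submK le) addmC mm'.
  suff -> : (1 *: (G * mpolyX K (mnm_sub m' m)))@_k = 0 by rewrite absval0.
  rewrite scale1r; apply/eqP; rewrite mcoeff_eq0; apply: contra nle => kG.
  have := msuppMX G (mnm_sub m' m).
  by move=> /perm_mem e; move: kG; rewrite e => /mapP[x _ ->]; exact: lem_addr.
exists i0 => i G UG.
have [i0i|ii0] := leqP i i0; first exact: Umono UG.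
have [Usmall _ UB _] := idU i0; have [_ U1 UBi _] := idU i.
have main : forall m G, U i G -> residual_lead G m -> U i0 G.
  apply: (@ltmwf N) => m IHm {}G {}UG [Gm Glt].
  have [G' UG' [Gm' Glt']] : L i0 m by apply: (i0P i); exists G.
  have [_ U1' _ UM'] := idU i0.
  pose c := G@_m / G'@_m.
  have c1 : nu c = 1 by rewrite absvalM // absvalV // Gm Gm' divr1.
  have G'm0 : G'@_m != 0 by rewrite -(absval_eq0 nuP) Gm' oner_neq0.
  have UcG' : U i0 (c *: G').
    by rewrite -[G']mulr1 -mpolyX0; apply: UM' => //; rewrite /valring c1.
  suff UGG' : U i0 (G - c *: G').
    have := UB _ _ UGG' (UB _ _ (Usmall 0 _) UcG').
    rewrite sub0r opprK subrK; apply.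
    by move=> k; rewrite mcoeff0 absval0.
  have UiGG' : U i (G - c *: G') by apply: UBi => //; apply: Umono UcG'; exact: ltnW.
  have [small|[k [Gk klt]]] := residual_lead_ex (U1 _ UiGG'); first exact: Usmall.
  (* The leading exponent [k] of the difference lies strictly below [m]: the coefficient at [m]
     cancels and both polynomials are small above [m]. *)
  apply: (IHm k) => //; rewrite ltNge le_eqVlt; apply/negP => /predU1P[mk|mk].
    move: Gk; rewrite -mk mcoeffB mcoeffZ /c divfK // subrr absval0 //.
    by apply/eqP; rewrite eq_sym oner_neq0.
  have : nu ((G - c *: G')@_k) < 1.
    rewrite mcoeffB mcoeffZ absvalB_lt ?Glt // absvalM_lt ?Glt' //.
    by rewrite /valring c1.
  by rewrite Gk ltxx.
have [small|[m Gm]] := residual_lead_ex (U1 _ UG); first exact: Usmall.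
exact: main Gm.
Qed.

End NoetherianModuloMaximalIdeal.

(** * Systems compatible with the Frobenius power map *)

Lemma expr_eventually_le (R : realType) (e c : R) :
  0 <= e < 1 -> 0 < c -> exists j, forall k, (j <= k)%N -> e ^+ k <= c.
Proof.
move=> /andP[e0 e1] c0.
have ne1 : `|e| < 1 by rewrite ger0_norm.
have /cvgrPdist_le/(_ c c0) [j _ jP] := cvg_expr ne1.
exists j => k /jP /=; rewrite sub0r normrN ger0_norm ?exprn_ge0 //.
Qed.

(** Bernoulli's inequality [1 - x ^ n <= n (1 - x)] gives a bound [d] independent of [x]. *)
Lemma root_bound (R : realType) (n : nat) (c : R) : (0 < n)%N -> c < 1 ->
  exists2 d : R, d < 1 & forall x : R, 0 <= x -> x ^+ n <= c -> x <= d.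
Proof.
move=> n0 c1; have nR : 0 < n%:R :> R by rewrite ltr0n.
exists (1 - (1 - c) / n%:R) => [|x x0 xc].
  by rewrite ltrBlDr ltrDl divr_gt0 // subr_gt0.
have x1 : x <= 1.
  rewrite leNgt; apply/negP => x1; have : 1 < x ^+ n by rewrite exprn_egt1 // -lt0n.
  by rewrite ltNge (le_trans xc (ltW c1)).
have bern : 1 - x ^+ n <= n%:R * (1 - x).
  elim: (n) => [|k IHk]; first by rewrite expr0 subrr mul0r.
  have : 0 <= x ^+ k <= 1 by rewrite exprn_ge0 // exprn_ile1.
  rewrite exprS -natr1; nra.
rewrite lerBrDl -lerBrDr ler_pdivrMr // mulrC; lra.
Qed.

Section CompatibleSystem.
Variables (R : realType) (K : fieldType) (nu : K -> R) (N p s0 : nat).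
Hypotheses (nuP : nonarch_absval nu) (p_prime : prime p) (p_small : nu p%:R < 1).
Hypothesis s0_gt0 : (0 < s0)%N.
Let q := (p ^ s0)%N.
Hypothesis residue_algebraic : forall x, valring nu x ->
  exists2 S : nat, (0 < S)%N & nu (x ^+ (q ^ S) - x) < 1.
Variable z : nat -> 'I_N -> K.
Hypotheses (z_int : forall n, valring_point nu (z n))
  (z_compat : forall n i, z n i = z n.+1 i ^+ q).
Implicit Types (G : mpoly N K) (m : multinom N).

Let q_gt0 : (0 < q)%N. Proof. by rewrite expn_gt0 prime_gt0. Qed.
Let q_gt1 : (1 < q)%N.
Proof. by rewrite -{1}(exp1n s0) ltn_exp2r // prime_gt1. Qed.
Let qX_gt0 k : (0 < q ^ k)%N. Proof. by rewrite expn_gt0 q_gt0. Qed.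
Let qX k : (q ^ k)%N = (p ^ (s0 * k))%N. Proof. by rewrite /q expnM. Qed.
Let ltn_qX k : (k < q ^ k)%N. Proof. exact: ltn_expl. Qed.

Lemma compatX n k : (fun i => z (n + k) i ^+ (q ^ k)) = z n.
Proof.
apply: funext => i; elim: k n => [|k IHk] n; first by rewrite addn0 expn0 expr1.
by rewrite addnS expnS exprM -z_compat IHk.
Qed.

Lemma residue_period x S k : valring nu x ->
  nu (x ^+ (q ^ S) - x) < 1 -> nu (x ^+ (q ^ (S * k)) - x) < 1.
Proof. by rewrite expnM; exact: absval_fixX. Qed.

Lemma coef_bound G (c : R) : 0 < c -> (forall m, nu (G@_m) < c) ->
  exists2 d, 0 <= d < c & forall m, nu (G@_m) <= d.
Proof.
move=> c0 Gc; exists (\big[Num.max/0]_(m <- msupp G) nu (G@_m)).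
  rewrite bigmax_ge_id /=; elim/big_ind: _ => // x y xc yc.
  by rewrite gt_max xc yc.
move=> m; have [mG|/memN_msupp_eq0 ->] := boolP (m \in msupp G).
  by apply: le_bigmax_seq.
by rewrite absval0 // bigmax_ge_id.
Qed.

(** Multiples of a period are periods, so the product of [s] and the periods of the finitely many
    coefficients works. *)
Lemma common_period s G : (0 < s)%N -> poly_over (valring nu) G ->
  exists S, [/\ (0 < S)%N, (s %| S)%N &
    forall m k, nu ((G@_m) ^+ (q ^ (S * k)) - G@_m) < 1].
Proof.
move=> s0' G1.
suff [S S0 SP] : exists2 S, (0 < S)%N & forall m, m \in msupp G ->
    nu ((G@_m) ^+ (q ^ S) - G@_m) < 1.
  exists (S * s)%N; split=> [||m k]; [by rewrite muln_gt0 S0|exact: dvdn_mull|].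
  rewrite -mulnA; apply: residue_period; first exact: G1.
  have [|/memN_msupp_eq0 ->] := boolP (m \in msupp G); first exact: SP.
  by rewrite expr0n expn_eq0 gtn_eqF //= subr0 absval0.
elim: (msupp G) => [|m r [S S0 SP]]; first by exists 1%N.
have [T T0 TP] := residue_algebraic (G1 m).
exists (S * T)%N => [|m']; first by rewrite muln_gt0 S0.
rewrite inE => /predU1P[->|/SP]; last exact/residue_period/G1.
by rewrite mulnC; apply: residue_period => //; exact: G1.
Qed.

Definition topologically_nilpotent (S : nat) G : Prop :=
  poly_over (valring nu) G /\
  exists2 d : R, d < 1 & forall k, nu (meval (z (S * k)) G) <= d.

Lemma topnil_ideal S : residual_ideal nu (topologically_nilpotent S).
Proof.
have VP := valring_subring nuP.
split=> [G Gs|G []//|G G' [G1 [d d1 Gd]] [G'1 [d' d'1 G'd]]|G c m c1 [G1 [d d1 Gd]]].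
- split=> [m|]; first by rewrite /valring ltW.
  have [d /andP[d0 d1] Gd] := coef_bound ltr01 Gs.
  by exists d => // k; exact: absval_meval_le.
- split; first exact: (subringB (poly_over_subring N VP)).
  exists (Num.max d d') => [|k]; first by rewrite gt_max d1.
  by rewrite mevalB absvalB_le // le_max ?Gd ?G'd ?orbT.
- split.
    apply: poly_overZ => //; apply: (subringM (poly_over_subring N VP)) => //.
    exact: poly_overX.
  exists d => // k; rewrite mevalZ absvalM_le // mevalM mulrC absvalM_le //.
  by rewrite mevalX /valring absval_monom.
Qed.

Lemma topnil_dvd S S' G : (S %| S')%N ->
  topologically_nilpotent S G -> topologically_nilpotent S' G.
Proof.
by move=> /dvdnP[k ->] [G1 [d d1 Gd]]; split=> //; exists d => // l; rewrite mulnAC mulnC.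
Qed.

(** Divisibility of the periods only orders these ideals partially; the factorials give an
    increasing chain reaching above every [S], to which noetherianity applies. *)
Lemma topnil_stable : exists2 s, (0 < s)%N &
  forall S G, (0 < S)%N -> topologically_nilpotent S G -> topologically_nilpotent s G.
Proof.
have [i j G ij|i0 i0P] :=
  @residual_ideal_noetherian _ _ _ _ nuP (fun i => topologically_nilpotent i`!)
    (fun i => topnil_ideal i`!).
  by apply: topnil_dvd; rewrite -(ffact_fact (leq_subr i j)) subKn // dvdn_mull.
exists (i0`!) => [|S G S0 GS]; first exact: fact_gt0.
by apply: (i0P S); apply: topnil_dvd GS; apply: dvdn_fact; rewrite S0 /=.
Qed.

Lemma meval_frobenius_compat G n k : poly_over (valring nu) G ->
  nu (meval (z (n + k)) G ^+ (q ^ k) - meval (z n) (twist (q ^ k) G)) <= nu p%:R.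
Proof.
move=> G1; have := absval_meval_frobenius nuP (s0 * k) p_prime G1 (z_int (n + k)).
by rewrite -qX compatX.
Qed.

Lemma twist_over G k : poly_over (valring nu) G -> poly_over (valring nu) (twist (q ^ k) G).
Proof.
move=> G1 m; rewrite mcoeff_twist ?qX_gt0 //.
exact/(subringX (valring_subring nuP))/G1.
Qed.

Variable s : nat.
Hypotheses (s_gt0 : (0 < s)%N) (s_stable : forall S G, (0 < S)%N ->
  topologically_nilpotent S G -> topologically_nilpotent s G).

(** Smallness on the single class of [s * i] modulo [S] spreads to all multiples of [s]: a twist
    moves the class to that of 0, where the stability of [s] applies, and the way back extracts a
    [q ^ n0]-th root. *)
Lemma topnil_of_class i S d G : (0 < S)%N -> (s %| S)%N ->
  poly_over (valring nu) G ->
  (forall m k, nu ((G@_m) ^+ (q ^ (S * k)) - G@_m) < 1) -> d < 1 ->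
  (forall k, nu (meval (z (s * i + S * k)) G) <= d) ->
  topologically_nilpotent s G.
Proof.
move=> S0 sS G1 GS d1 Gd; pose n0 := (s * i)%N.
have [d' d'1 Gd'] : exists2 d' : R, d' < 1 &
    forall k, nu (meval (z (s * k)) (twist (q ^ n0) G)) <= d'.
  suff [] : topologically_nilpotent s (twist (q ^ n0) G) by [].
  apply: (s_stable S0); split; first exact: twist_over.
  exists (Num.max d (nu p%:R)) => [|k]; first by rewrite gt_max d1.
  apply: (absval_le_close nuP (y := meval (z (S * k + n0)) G ^+ (q ^ n0))).
    by rewrite absvalBC // le_max meval_frobenius_compat ?orbT.
  rewrite le_max absvalX // addnC; apply/orP; left; apply: le_trans (Gd k).
  rewrite ler_iXnr ?qX_gt0 ?absval_ge0 //; exact: absval_meval_le.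
have [||e e1 eP] := @root_bound R (q ^ n0) (Num.max d' (nu p%:R)).
- exact: qX_gt0.
- by rewrite gt_max d'1.
have large k : nu (meval (z (s * k + n0)) G) <= e.
  apply: eP; rewrite ?absval_ge0 // -absvalX //.
  apply: (absval_le_close nuP (y := meval (z (s * k)) (twist (q ^ n0) G))).
    by rewrite le_max meval_frobenius_compat ?orbT.
  by rewrite le_max Gd'.
(* So far only the multiples of [s] from [n0] on are covered. A shift by [S * i >= n0] reaches the
   others, since the corresponding twist alters [G] by small coefficients only. *)
have [d0 /andP[d00 d01] d0P] : exists2 d0, 0 <= d0 < 1 &
    forall m, nu ((twist (q ^ (S * i)) G - G)@_m) <= d0.
  apply: coef_bound => // m; rewrite mcoeffB mcoeff_twist ?qX_gt0 //.
split=> //; exists (Num.max e (Num.max (nu p%:R) d0)) => [|k].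
  by rewrite !gt_max e1 p_small.
have [t St] : exists t, (s * k + S * i = s * t + n0)%N.
  have /dvdnP[[|u] SE] := sS; first by rewrite SE in S0.
  by exists (k + u * i)%N; rewrite SE /n0 mulSn; ring.
have S_large : nu (meval (z (s * k + S * i)) G) <= e by rewrite St.
apply: (absval_le_close nuP (y := meval (z (s * k)) (twist (q ^ (S * i)) G))).
  rewrite absvalBC // -mevalB.
  apply: le_trans (absval_meval_le nuP d00 (z_int _) d0P) _.
  by rewrite !le_max lexx !orbT.
apply: (absval_le_close nuP (y := meval (z (s * k + S * i)) G ^+ (q ^ (S * i)))).
  by rewrite absvalBC // !le_max meval_frobenius_compat ?orbT.
rewrite le_max absvalX //; apply/orP; left; apply: le_trans S_large.
rewrite ler_iXnr ?qX_gt0 ?absval_ge0 //; exact: absval_meval_le.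
Qed.

(* Along multiples of the period, passing from index [n] to [n + S] extracts a
   [q ^ S]-th root up to an error bounded away from 1; so the absolute value of
   [G] tends to 1 on each class on which it exceeds that error once. *)
Lemma topnil_or_unit G : poly_over (valring nu) G ->
  topologically_nilpotent s G \/
  forall e, 0 <= e < 1 -> exists k0, forall k, (k0 <= k)%N ->
    e < nu (meval (z (s * k)) G).
Proof.
move=> G1; have [S [S0 sS GS]] := common_period s_gt0 G1.
have [d0 /andP[d00 d01] d0P] : exists2 d0, 0 <= d0 < 1 &
    forall m, nu ((twist (q ^ S) G - G)@_m) <= d0.
  apply: coef_bound => // m; rewrite mcoeffB mcoeff_twist ?qX_gt0 //.
  by have := GS m 1%N; rewrite muln1.
pose d := Num.max d0 (nu p%:R); have d1 : d < 1 by rewrite gt_max d01.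
have step n : nu (meval (z (n + S)) G ^+ (q ^ S) - meval (z n) G) <= d.
  apply: (absval_le_trans nuP (y := meval (z n) (twist (q ^ S) G))).
    by rewrite le_max meval_frobenius_compat ?orbT.
  by rewrite -mevalB le_max absval_meval_le.
(* Either some class stays below the error [d], or every class exceeds it at least once. *)
have [[i iP]|nobad] := pselect (exists i, forall k, nu (meval (z (s * i + S * k)) G) <= d).
  by left; exact: (topnil_of_class S0 sS G1 GS d1 iP).
right=> e /andP[e0 e1].
have class i : exists k0, forall k, (k0 <= k)%N -> e < nu (meval (z (s * i + S * k)) G).
  have [a aP] : exists a, d < nu (meval (z (s * i + S * a)) G).
    apply: contrapT => no; apply: nobad; exists i => k.
    by rewrite leNgt; apply/negP => dk; apply: no; exists k.
  (* Above [d] the error in [step] does not affect absolute values, and extracting roots only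
     increases them, so they remain above [d]. *)
  have root j : nu (meval (z (s * i + S * (a + j))) G) ^+ (q ^ (S * j)) =
      nu (meval (z (s * i + S * a)) G).
    elim: j => [|j IHj]; first by rewrite muln0 expn0 expr1 addn0.
    have IHd : d < nu (meval (z (s * i + S * (a + j))) G).
      rewrite (lt_le_trans aP) // -IHj ler_iXnr ?qX_gt0 ?absval_ge0 //.
      exact: absval_meval_le.
    rewrite -IHj mulnS expnD exprM; congr (_ ^+ _).
    rewrite -absvalX // addnS mulnSr addnA; apply: absval_eq => //.
    by rewrite absvalBC // (le_lt_trans (step _)).
  have a0 : 0 < nu (meval (z (s * i + S * a)) G).
    by apply: le_lt_trans aP; rewrite le_max d00.
  have [||j0 j0P] := @expr_eventually_le _ e (nu (meval (z (s * i + S * a)) G) / 2).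
  - by rewrite e0.
  - by rewrite divr_gt0.
  exists (a + j0)%N => k jk; rewrite ltNge; apply/negP => ke.
  have [j [jj {}ke]] : exists j, (j0 <= j)%N /\ nu (meval (z (s * i + S * (a + j))) G) <= e.
    have ak : (a <= k)%N := leq_trans (leq_addr _ _) jk.
    by exists (k - a)%N; rewrite subnKC // leq_subRL.
  have := j0P (q ^ (S * j))%N; rewrite leqNgt => /(_ _)/le_gtF/negP.
  apply.
    rewrite -leqNgt (leq_trans jj) // ltnW // (leq_ltn_trans _ (ltn_qX _)) //.
    by rewrite leq_pmull.
  rewrite (lt_le_trans (y := nu (meval (z (s * i + S * a)) G))) //.
    by rewrite ltr_pdivrMr // mulr_natr mulr2n ltrDl.
  by rewrite -(root j) lerXn2r ?nnegrE ?absval_ge0.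
have [f fP] := choice class.
have sS_gt0 : (0 < S %/ s)%N by rewrite divn_gt0 // dvdn_leq.
(* The class of [s * k] modulo [S] is given by [k] modulo [S / s], so finitely many thresholds
   matter. *)
pose M := \max_(i < S %/ s) f i.
exists (S %/ s * M.+1)%N => k kM.
have iS : (k %% (S %/ s) < S %/ s)%N by rewrite ltn_pmod.
have -> : (s * k = s * (k %% (S %/ s)) + S * (k %/ (S %/ s)))%N.
  rewrite {1}(divn_eq k (S %/ s)) mulnDr addnC; congr (_ + _)%N.
  by rewrite mulnCA mulnC (mulnC s) divnK.
apply: fP; apply: leq_trans (_ : M <= _)%N.
  exact: (@leq_bigmax _ (fun i : 'I_(S %/ s) => f i) (Ordinal iS)).
by rewrite leq_divRL // mulnC (leq_trans _ kM) // leq_mul2l leqnSn orbT.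
Qed.

(** * Polynomials with coefficients in a discrete valuation ring *)

Section DiscreteCoefficients.
Variables (D : K -> Prop) (pi : K).
Hypotheses (DP : is_subring D) (D_int : forall x, D x -> valring nu x).
Hypotheses (pi0 : pi != 0) (pi_small : nu pi < 1).
Hypothesis D_div : forall x, D x -> nu x < 1 -> D (x / pi).

Lemma discrete_le x : D x -> nu x < 1 -> nu x <= nu pi.
Proof.
move=> Dx x1; have := D_int (D_div Dx x1).
by rewrite /valring absvalM // absvalV // ler_pdivrMr ?absval_gt0 // mul1r.
Qed.

(* Replace the coefficients [a] of [G] by powers [a ^ (q ^ _)], nearly fixed by
   [x |-> x ^ M]: the resulting [G'] satisfies
   [G'(z_(n+k)) ^ M = G'(z_n) + p h(z_(n+k))] up to a small error, and the
   left-hand side is negligible. *)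
Lemma topnil_divide j G : poly_over D G -> topologically_nilpotent s G ->
  exists (t : nat) (G1 : mpoly N K), poly_over D G1 /\
    forall k, nu (meval (z (s * k)) G - pi * meval (z (s * (k + t))) G1) <= nu pi ^+ j.
Proof.
move=> DG [G1 [d d1 Gd]]; have [S [S0 sS GS]] := common_period s_gt0 G1.
have pi_ge0 : 0 <= nu pi := absval_ge0 nuP _.
have Dp : D p%:R by exact: subring_nat.
have p_pi : nu p%:R <= nu pi by exact: discrete_le.
have DX x k : D x -> D (x ^+ k) by exact: subringX.
(* Discreteness improves the bound [< 1] to [<= nu pi]; raising to the power [q ^ (S * j)] then
   improves it to [nu pi ^+ j]. *)
have GSpi m k : nu ((G@_m) ^+ (q ^ (S * k)) - G@_m) <= nu pi.
  by apply: discrete_le => //; apply: subringB => //; exact: DX.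
pose G' := twist (q ^ (S * j)) G.
have G'E m : G'@_m = (G@_m) ^+ (q ^ (S * j)) by rewrite mcoeff_twist ?qX_gt0.
have DG' : poly_over D G' by move=> m; rewrite G'E; exact: DX.
have G'_fixed k m : nu ((G'@_m) ^+ (q ^ (S * k)) - G'@_m) <= nu pi ^+ j.
  rewrite G'E exprAC (qX (S * j)).
  have := absval_subX_primeX nuP (s0 * (S * j)) (prime_gt0 p_prime) (D_int (DX _ _ (DG m)))
    (D_int (DG m)) p_pi (ltW pi_small) (lexx _) (GSpi m k).
  move=> /le_trans; apply; rewrite -exprSr ler_wiXn2l //; first exact: ltW.
  by rewrite (leq_trans _ (leqnSn _)) // mulnA leq_pmull // muln_gt0 s0_gt0.
pose G2 := pi^-1 *: (G - G').
have DG2 : poly_over D G2.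
  move=> m; rewrite mcoeffZ mcoeffB mulrC; apply: D_div; first exact: subringB.
  rewrite absvalBC // G'E (le_lt_trans (GSpi _ _)) //.
pose e := Num.max (Num.max d (nu pi)) 0.
have e1 : 0 <= e < 1 by rewrite le_max lexx orbT /= !gt_max d1 pi_small ltr01.
have G'e k : nu (meval (z (s * k)) G') <= e.
  apply: (absval_le_close nuP (y := meval (z (s * k)) G)); last by rewrite !le_max Gd.
  rewrite -mevalB; apply: le_trans (_ : nu pi <= _); last by rewrite !le_max lexx orbT.
  by apply: absval_meval_le => // m; rewrite mcoeffB G'E.
(* [l] makes [e ^ M] negligible, because [M = q ^ (S * l)] is at least [l]. *)
have [||l lP] := @expr_eventually_le _ e (nu pi ^+ j); [by []|by rewrite exprn_gt0 ?absval_gt0|].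
pose M := (q ^ (S * l))%N.
have [h Dh hE] := frobenius_meval DP (s0 * (S * l)) p_prime DG'.
(* Substituting [M]-th powers rewrites values at [z n] as values at [z (n + S * l)], the point where
   [h] is evaluated. *)
pose XM : N.-tuple (mpoly N K) := [tuple mpolyX K (mnm_muln (mnm1 i) M) | i < N].
have XME n : (fun i => meval (z (n + S * l)) (tnth XM i)) = z n.
  rewrite -(compatX n (S * l)); apply: funext => i.
  by rewrite tnth_mktuple -mpolyXn rmorphXn /= mevalXU.
(* The shift [t] satisfies [s * t = S * l]. *)
exists (S %/ s * l)%N, (comp_mpoly XM G2 - (p%:R / pi) *: h); split=> [|k].
  apply: (subringB (poly_over_subring N DP)).
    apply: poly_over_comp => // i; rewrite tnth_mktuple; exact: poly_overX.
  by apply: poly_overZ => //; exact: D_div.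
have kE : (s * (k + S %/ s * l) = s * k + S * l)%N.
  by rewrite mulnDr mulnA [(s * (S %/ s))%N]mulnC divnK.
rewrite kE; set n := (s * k)%N; rewrite mevalB mevalZ meval_comp XME mevalZ mevalB.
have -> : meval (z n) G - pi * (pi^-1 * (meval (z n) G - meval (z n) G') -
    p%:R / pi * meval (z (n + S * l)) h) =
    meval (z n) G' + p%:R * meval (z (n + S * l)) h by field.
have := hE (z (n + S * l)); rewrite -qX compatX -/M => hE'.
have -> : meval (z n) G' + p%:R * meval (z (n + S * l)) h =
    meval (z (n + S * l)) G' ^+ M - meval (z n) (twist M G' - G').
  by rewrite hE' mevalB; ring.
have [e0 _] := andP e1.
apply: absvalB_le => //.
  rewrite -kE absvalX //; apply: le_trans (lP M _).
    by rewrite lerXn2r ?nnegrE ?(absval_ge0 nuP) //; exact: G'e.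
  by rewrite ltnW // (leq_ltn_trans _ (ltn_qX _)) // leq_pmull.
apply: absval_meval_le => [//|||m]; [exact: exprn_ge0|exact: z_int|].
by rewrite mcoeffB mcoeff_twist; [exact: G'_fixed|exact: qX_gt0].
Qed.

(** Induction on [j]. Infinitely many small values exclude convergence to 1, so [G] is divisible by
    [pi] in the sense of [topnil_divide]; order [j + 1] for [G] at [k] then amounts to order [j] for
    the quotient [G1] at [k + t]. *)
Lemma small_often_small_always j G : poly_over D G ->
  (forall k0, exists2 k, (k0 <= k)%N & nu (meval (z (s * k)) G) <= nu pi ^+ j) ->
  forall k, nu (meval (z (s * k)) G) <= nu pi ^+ j.
Proof.
have pi_ge0 : 0 <= nu pi := absval_ge0 nuP _.
elim: j G => [|j IHj] G DG often k.
  by rewrite expr0; apply: absval_meval_le => // m; exact/D_int/DG.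
have Gint : poly_over (valring nu) G by move=> m; exact/D_int/DG.
case: (topnil_or_unit Gint) => [Gnil|/(_ (nu pi ^+ j.+1))[|k0 k0P]]; last first.
- have [k1 /k0P] := often k0; by rewrite ltNge => /negP.
- by rewrite exprn_ge0 // exprn_ilt1.
have [t [G1 [DG1 GE]]] := topnil_divide j.+1 DG Gnil.
have equiv l : (nu (meval (z (s * l)) G) <= nu pi ^+ j.+1) =
    (nu (meval (z (s * (l + t))) G1) <= nu pi ^+ j).
  have -> : (nu (meval (z (s * (l + t))) G1) <= nu pi ^+ j) =
    (nu (pi * meval (z (s * (l + t))) G1) <= nu pi ^+ j.+1).
    by rewrite absvalM // exprS ler_pM2l // absval_gt0.
  apply/idP/idP => /(absval_le_close nuP); apply => //.
  by rewrite absvalBC.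
rewrite equiv; apply: IHj => // k0.
have [k1 kk1] := often k0; rewrite equiv => small.
by exists (k1 + t)%N; rewrite // (leq_trans kk1) // leq_addr.
Qed.

End DiscreteCoefficients.

End CompatibleSystem.

(** * Discrete valuation rings in C_p *)

Section PadicValues.
Variables (R : realType) (p : nat).
Hypothesis p_prime : prime p.
Variables (Qp : fieldType) (nuQp : Qp -> R) (f : {rmorphism rat -> Qp}).
Hypothesis Qp_completion : is_completion (@padic_absval R p) nuQp f.

Let nuP : nonarch_absval nuQp. Proof. by case: Qp_completion. Qed.
Let nuf x : nuQp (f x) = padic_absval R p x. Proof. by case: Qp_completion. Qed.
Let Qp_dense (x : Qp) (e : R) : 0 < e -> exists y : rat, nuQp (x - f y) < e.
Proof. by case: Qp_completion => _ _ _; exact. Qed.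

Lemma absval_p : nuQp p%:R = p%:R^-1.
Proof.
have p1 := prime_gt1 p_prime; have p0 := ltnW p1.
have pq0 : p%:R != 0 :> rat by rewrite pnatr_eq0 -lt0n.
rewrite -(rmorph_nat f) nuf /padic_absval (negbTE pq0).
have -> : p%:R = (p%:Z)%:Q :> rat by [].
by rewrite numq_int denq_int /= logn1 logn_prime // eqxx sub0r -exprN1.
Qed.

Lemma absval_p_lt1 : nuQp p%:R < 1.
Proof.
by rewrite absval_p invf_lt1 ?ltr1n ?ltr0n ?prime_gt1 ?prime_gt0.
Qed.

Lemma padic_value x : x != 0 -> exists k : int, nuQp x = p%:R ^ k.
Proof.
move=> x0; have [r xr] := @Qp_dense x (nuQp x) (etrans (absval_gt0 nuP x) x0).
have rE := absval_eq nuP xr.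
have r0 : r != 0.
  apply: contraNneq x0 => r0; rewrite -(absval_eq0 nuP) -rE r0 rmorph0.
  by rewrite (absval0 nuP).
by rewrite -rE nuf /padic_absval (negbTE r0); eexists.
Qed.

Lemma absval_int_dvd (k : int) : (p%:Z %| k)%Z -> nuQp k%:~R < 1.
Proof.
move=> /dvdzP[l ->]; rewrite intrM absvalM_lt //; last exact: absval_p_lt1.
case: l => l; rewrite /valring; first exact: absval_nat.
by rewrite NegzE mulrNz absvalN //; exact: absval_nat.
Qed.

(** Density gives a nearby rational with denominator prime to [p], and a Bezout relation inverts
    that denominator modulo [p]. *)
Lemma padic_digit x : nuQp x <= 1 -> exists a : int, nuQp (x - a%:~R) < 1.
Proof.
move=> x1; have [r xr] := @Qp_dense x 1 ltr01.
have r1 : nuQp (f r) <= 1.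
  by apply: (absval_le_close nuP) x1; rewrite absvalBC // ltW.
have pden : ~~ (p %| `|denq r|)%N.
  have [->|r0] := eqVneq r 0; first by rewrite dvdn1 gtn_eqF ?prime_gt1.
  apply/negP => pd; move: r1; rewrite nuf /padic_absval (negbTE r0).
  have -> : logn p `|numq r|%N = 0%N.
    apply/eqP; rewrite lognE p_prime /=; case: ifP => // /andP[_ pn].
    have /eqP := coprime_num_den r; have : (p %| gcdn `|numq r| `|denq r|)%N by rewrite dvdn_gcd pn.
    by move=> + g1; rewrite g1 dvdn1 gtn_eqF ?prime_gt1.
  rewrite subr0 -exprnP leNgt exprn_egt1 ?ltr1n ?prime_gt1 //.
  by rewrite -lt0n logn_gt0 mem_primes p_prime absz_gt0 denq_neq0 pd.
have : coprimez p%:Z (denq r) by rewrite coprimezE prime_coprime.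
move=> /coprimezP[[u v] /= uv].
have den : f r * (denq r)%:~R = (numq r)%:~R.
  rewrite -(rmorph_int f) -(rmorph_int f (numq r)) -rmorphM; congr (f _).
  by rewrite -{1}(divq_num_den r) mulfVK // intr_eq0 denq_neq0.
exists (numq r * v); apply: (absval_lt_trans nuP xr).
have -> : f r - (numq r * v)%:~R = f r * (u * p%:Z)%:~R.
  rewrite intrM -den -{1}[f r]mulr1 -mulrA -mulrBr; congr (_ * _).
  by rewrite -intrM -[1]/(1%:~R) -intrB; congr (_%:~R); rewrite -uv; ring.
by rewrite absvalM_lt // absval_int_dvd // dvdz_mull.
Qed.

End PadicValues.

(** * Elements algebraic over a discretely valued field *)

Section AlgebraicElements.
Variables (R : realType) (p : nat).
Hypothesis p_prime : prime p.
Variables (k K : fieldType) (nuk : k -> R) (nu : K -> R) (iota : {rmorphism k -> K}).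
Hypotheses (nukP : nonarch_absval nuk) (nuP : nonarch_absval nu).
Hypothesis nu_iota : forall x, nu (iota x) = nuk x.
Hypothesis nu_p : nuk p%:R = p%:R^-1.
Hypothesis k_value : forall x, x != 0 -> exists j : int, nuk x = p%:R ^ j.
Hypothesis k_digit : forall x, nuk x <= 1 -> exists a : int, nuk (x - a%:~R) < 1.
Hypothesis algebraic_dense : forall (y : K) (e : R), 0 < e ->
  exists2 x, algebraicOver iota x & nu (y - x) < e.

Let nuKp : nu p%:R = p%:R^-1. Proof. by rewrite -nu_p -nu_iota rmorph_nat. Qed.
Let p_small : nu p%:R < 1.
Proof. by rewrite nuKp invf_lt1 ?ltr1n ?ltr0n ?prime_gt1 ?prime_gt0. Qed.

Lemma absval_int (a : int) : valring nu a%:~R.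
Proof.
case: a => a; rewrite /valring; first exact: absval_nat.
by rewrite NegzE mulrNz absvalN //; exact: absval_nat.
Qed.

Lemma pigeonhole_nat (T : finType) (F : nat -> T) : exists i j, (i < j)%N /\ F i = F j.
Proof.
have /injectivePn[i [j ij Fij]] : ~~ injectiveb (fun i : 'I_(#|T|.+1) => F i).
  by apply/negP => /injectiveP/leq_card; rewrite card_ord ltnn.
by move: ij; rewrite neq_ltn => /orP[]; [exists i, j|exists j, i].
Qed.

Lemma absval_int_modz (a : int) : nu (a%:~R - (a %% p%:Z)%Z%:~R) < 1.
Proof.
rewrite {1}(divz_eq a p%:Z) intrD addrK intrM absvalM_lt //.
exact: absval_int.
Qed.

(* Some power of [y] is congruent to an integral combination of lower powers:
   normalize an annihilating polynomial at its last coefficient of maximal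
   absolute value. *)
Lemma residue_monic_relation y : valring nu y -> exists (d : nat) (a : nat -> int),
  nu (y ^+ d - \sum_(i < d) (a i)%:~R * y ^+ i) < 1.
Proof.
move=> y1; have [x [P P0 Px] xy] := algebraic_dense y ltr01.
have x1 : valring nu x by apply: (absval_le_close nuP) y1; rewrite absvalBC // ltW.
have sP : (0 < size P)%N by rewrite size_poly_gt0.
have ex : exists d, `[< (d < size P)%N /\ forall j, nuk P`_j <= nuk P`_d >].
  case: (@Order.TotalTheory.arg_maxP _ _ _ (Ordinal sP) xpredT
    (fun i : 'I_(size P) => nuk P`_i) isT) => i _ imax.
  exists i; apply/asboolP; split=> // j.
  have [jP|jP] := ltnP j (size P); first exact: (imax (Ordinal jP)).
  by rewrite nth_default // absval0 // absval_ge0.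
have bound d : `[< (d < size P)%N /\ forall j, nuk P`_j <= nuk P`_d >] -> (d <= size P)%N.
  by move=> /asboolP[/ltnW].
have [d /asboolP[dP dmax] dlast] := ex_maxnP ex bound.
have Pd0 : P`_d != 0.
  have := dmax (size P).-1; rewrite -lead_coefE => le; rewrite -(absval_gt0 nukP).
  by rewrite (lt_le_trans _ le) // absval_gt0 // lead_coef_eq0.
pose c j := P`_j / P`_d.
have c_le j : nuk (c j) <= 1.
  by rewrite absvalM // absvalV // ler_pdivrMr ?absval_gt0 // mul1r.
have c_lt j : (d < j)%N -> nuk (c j) < 1.
  move=> dj; rewrite lt_neqAle c_le andbT; apply/eqP => cj.
  have cE : P`_j = c j * P`_d by rewrite /c divfK.
  suff /dlast : `[< (j < size P)%N /\ forall i, nuk P`_i <= nuk P`_j >].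
    by rewrite leqNgt dj.
  apply/asboolP; split=> [|i]; last by rewrite cE absvalM // cj mul1r.
  rewrite ltnNge; apply/negP => /(nth_default 0) Pj0; move: cj.
  by rewrite /c Pj0 mul0r absval0 // => /eqP; rewrite eq_sym oner_eq0.
have [a aP] := choice (fun i => k_digit (c_le i)).
exists d, (fun i => - a i).
have T0 : \sum_(0 <= i < size P) iota (c i) * x ^+ i = 0.
  have := Px; rewrite rootE horner_poly => /eqP Px0.
  rewrite big_mkord -[RHS](mulr0 (iota P`_d)^-1) -[X in _ * X]Px0 mulr_sumr.
  by apply: eq_bigr => i _; rewrite /c fmorph_div mulrA [_ / _]mulrC.
rewrite (big_cat_nat (n := d)) //= in T0; last exact: ltnW.
rewrite big_mkord big_ltn // in T0.
have c_d : c d = 1 by rewrite /c divff.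
rewrite c_d rmorph1 mul1r in T0.
(* Subtracting the vanishing relation for [x] leaves three small parts: differences of powers of [y]
   and [x], digit errors, and the terms beyond [d]. *)
rewrite -[X in nu X]subr0 -[X in _ - X]T0.
have -> : y ^+ d - \sum_(i < d) (- a i)%:~R * y ^+ i -
  (\sum_(i < d) iota (c i) * x ^+ i +
    (x ^+ d + \sum_(d.+1 <= i < size P) iota (c i) * x ^+ i)) =
  (y ^+ d - x ^+ d) + \sum_(i < d) ((a i)%:~R * y ^+ i - iota (c i) * x ^+ i) -
    \sum_(d.+1 <= i < size P) iota (c i) * x ^+ i.
  rewrite sumrB (eq_bigr (fun i : 'I_d => - ((a i)%:~R * y ^+ i))) => [|i _].
    by rewrite sumrN; ring.
  by rewrite mulrNz mulNr.
have xX i : valring nu (x ^+ i) by exact: (subringX (valring_subring nuP)).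
apply: absvalB_lt => //.
  apply: absvalD_lt => //; first exact: absval_subX_lt.
  apply: absval_sum_lt => // i _.
  have -> : (a i)%:~R * y ^+ i - iota (c i) * x ^+ i =
    (a i)%:~R * (y ^+ i - x ^+ i) - x ^+ i * iota (c i - (a i)%:~R).
    by rewrite rmorphB /= rmorph_int; ring.
  apply: absvalB_lt => //; apply: absvalM_lt => //; first exact: absval_int.
    exact: absval_subX_lt.
  by rewrite nu_iota.
rewrite big_nat_cond; elim/big_ind: _ => [|u v|i]; first by rewrite absval0.
  exact: absvalD_lt.
by rewrite andbT mulrC => /andP[di _]; apply: absvalM_lt => //; rewrite nu_iota c_lt.
Qed.

(** Modulo the maximal ideal, the powers of [y] are integral combinations of the first [d] ones with
    coefficients modulo [p], hence finitely many. Two of the [y ^ (p ^ j)] thus agree, and the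
    injectivity of Frobenius on residues lowers the smaller index to 0. *)
Lemma residue_algebraic y : valring nu y ->
  exists2 S : nat, (0 < S)%N & nu (y ^+ (p ^ S) - y) < 1.
Proof.
move=> y1; have [d [a ya]] := residue_monic_relation y1.
have p0 := prime_gt0 p_prime.
have VP := valring_subring nuP.
have yX i : valring nu (y ^+ i) by exact: (subringX VP).
have d0 : (0 < d)%N.
  rewrite lt0n; apply/eqP => d0; move: ya.
  by rewrite d0 expr0 big_ord0 subr0 absval1 // ltxx.
pose spanned x (c : nat -> int) := nu (x - \sum_(i < d) (c i)%:~R * y ^+ i) < 1.
have span j : exists c, spanned (y ^+ j) c.
  elim: j => [|j [c cP]].
    exists (fun i => (i == 0)%:Z); rewrite /spanned -(prednK d0) big_ord_recl /= expr0 mulr1.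
    by rewrite big1 => [|i _]; rewrite ?mul0r // addr0 subrr absval0.
  (* Multiplication by [y] shifts the coordinates, and the overflow in [y ^ d] is replaced by means
     of its relation. *)
  pose c' (i : nat) : int := if i is i'.+1 then c i' else 0.
  exists (fun i => c' i + c d.-1 * a i).
  rewrite /spanned; apply: (absval_lt_trans nuP (y := (\sum_(i < d) (c i)%:~R * y ^+ i) * y)).
    by rewrite exprSr -mulrBl mulrC absvalM_lt.
  have -> : (\sum_(i < d) (c i)%:~R * y ^+ i) * y =
      \sum_(i < d) (c' i)%:~R * y ^+ i + (c d.-1)%:~R * y ^+ d.
    rewrite -(prednK d0) big_ord_recr /= [in RHS]big_ord_recl /= mul0r add0r.
    rewrite mulrDl mulr_suml; congr (_ + _); last by rewrite -mulrA -exprSr.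
    by apply: eq_bigr => i _; rewrite -mulrA -exprSr.
  have -> : \sum_(i < d) (c' i + c d.-1 * a i)%:~R * y ^+ i =
      \sum_(i < d) (c' i)%:~R * y ^+ i + (c d.-1)%:~R * \sum_(i < d) (a i)%:~R * y ^+ i.
    rewrite mulr_sumr -big_split; apply: eq_bigr => i _ /=.
    by rewrite intrD intrM mulrDl mulrA.
  by rewrite opprD addrACA subrr add0r -mulrBr absvalM_lt //; exact: absval_int.
have [c cP] := choice (fun j => span (p ^ j)%N).
pose residue (b : int) : 'I_p.-1.+1 := inord `|(b %% p%:Z)%Z|%N.
have residue_eq b b' : residue b = residue b' -> nu (b%:~R - b'%:~R) < 1.
  have lt b0 : (`|(b0 %% p%:Z)%Z| < p.-1.+1)%N.
    by rewrite prednK // -ltz_nat gez0_abs ?modz_ge0 ?ltz_pmod // -lt0n.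
  move=> /(congr1 val); rewrite /= !inordK // => /(congr1 Posz).
  rewrite !gez0_abs ?modz_ge0 -?lt0n // => bb'.
  apply: (absval_lt_trans nuP (absval_int_modz b)); rewrite bb' absvalBC //.
  exact: absval_int_modz.
have [j [l [jl /ffunP cjl]]] :=
  pigeonhole_nat (fun j => [ffun i : 'I_d => residue (c j i)]).
have yjl : nu (y ^+ (p ^ l) - y ^+ (p ^ j)) < 1.
  apply: (absval_lt_trans nuP (cP l)).
  rewrite absvalBC //; apply: (absval_lt_trans nuP (cP j)).
  rewrite -sumrB; apply: absval_sum_lt => // i _.
  rewrite -mulrBl mulrC absvalM_lt // residue_eq //.
  by have := cjl i; rewrite !ffunE.
exists (l - j)%N; first by rewrite subn_gt0.
have w1 : valring nu (y ^+ (p ^ (l - j)) - y) by exact: subringB.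
have [h h1] := frobenius_expD VP p_prime j w1 y1.
rewrite subrK -exprM -expnD subnK; last exact: ltnW.
move=> e; rewrite ltNge; apply/negP => w_ge1.
have : nu ((y ^+ (p ^ (l - j)) - y) ^+ (p ^ j)) < 1.
  have -> : (y ^+ (p ^ (l - j)) - y) ^+ (p ^ j) =
    y ^+ (p ^ l) - y ^+ (p ^ j) - h * p%:R by rewrite e; ring.
  by apply: absvalB_lt => //; exact: absvalM_lt.
by rewrite absvalX // ltNge exprn_ege1.
Qed.

Lemma primitive_element (l : seq K) : (forall x, x \in l -> algebraicOver iota x) ->
  [pchar k] =i pred0 ->
  exists2 y, algebraicOver iota y &
    forall x, x \in l -> exists r : {poly k}, (map_poly iota r).[y] = x.
Proof.
move=> + char0; elim: l => [|x l IHl] lalg.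
  by exists 0 => //; exists 'X; rewrite ?polyX_eq0 // map_polyX rootX.
have [y [P P0 Py] yl] : exists2 y, algebraicOver iota y &
    forall x, x \in l -> exists r : {poly k}, (map_poly iota r).[y] = x.
  by apply: IHl => x' x'l; apply: lalg; rewrite inE x'l orbT.
have [Q Q0 Qx] := lalg x (mem_head _ _).
have [n /= [[ry ryE] [rx rxE]]] := pchar0_PET P0 Py Q0 Qx char0.
exists (x *+ n - y).
  apply: algebraic_sub; last by exists P.
  by rewrite -mulr_natr -(rmorph_nat iota); apply: algebraic_mul; [exists Q|exact: algebraic_id].
move=> x'; rewrite inE => /predU1P[->|/yl[r <-]]; first by exists rx.
by exists (r \Po ry); rewrite map_comp_poly horner_comp ryE.
Qed.

Section SimpleExtension.
Variables (y : K) (A : {poly k}).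
Hypotheses (A0 : A != 0) (Ay : root (map_poly iota A) y).
Let d := (size A).-1.
Let ev (r : {poly k}) : K := (map_poly iota r).[y].

(** The [d + 1] remainders of powers of [r] modulo [A] lie in dimension [d]. The degree bound is
    uniform in [r], which makes the exponent in [ev_value] uniform. *)
Lemma bounded_degree_annihilator (r : {poly k}) :
  exists P : {poly k}, [/\ P != 0, (size P <= d.+1)%N & root (map_poly iota P) (ev r)].
Proof.
have sA : size A = d.+1 by rewrite /d prednK // size_poly_gt0.
pose R_ i := (r ^+ i) %% A.
have sR i : (size (R_ i) <= d)%N by rewrite -ltnS -sA ltn_modp.
have evR i : ev (R_ i) = ev r ^+ i.
  have /(congr1 ev) := divp_eq (r ^+ i) A.
  rewrite /ev rmorphD rmorphM rmorphXn /= hornerD hornerM horner_exp (rootP Ay).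
  by rewrite mulr0 add0r.
pose M : 'M[k]_(d.+1, d) := \matrix_(i, j) (R_ i)`_j.
have kM : kermx M != 0.
  rewrite -mxrank_eq0 mxrank_ker subn_eq0 -ltnNge ltnS; exact: rank_leq_col.
have [v vM v0] := rowV0Pn kM.
have vM0 : v *m M = 0 by apply/sub_kermxP.
exists (\poly_(i < d.+1) v 0 (inord i)); split; last 2 first.
- exact: size_poly.
- apply/rootP; rewrite (horner_coef_wide (n := d.+1)); last first.
    by rewrite size_map_poly size_poly.
  transitivity (\sum_(j < d) iota ((v *m M) 0 j) * y ^+ j); last first.
    by rewrite big1 // => j _; rewrite vM0 mxE rmorph0 mul0r.
  rewrite (eq_bigr (fun i : 'I_d.+1 =>
    \sum_(j < d) iota (v 0 i) * (iota (R_ i)`_j * y ^+ j))) => [|i _].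
    rewrite exchange_big; apply: eq_bigr => j _ /=.
    by rewrite mxE rmorph_sum mulr_suml; apply: eq_bigr => i _; rewrite mxE rmorphM mulrA.
  rewrite coef_map coef_poly ltn_ord inord_val -evR -mulr_sumr /=; congr (_ * _).
  rewrite /ev (horner_coef_wide (n := d)) ?size_map_poly //.
  by apply: eq_bigr => j _; rewrite coef_map.
apply: contraNneq v0 => /polyP P0; apply/eqP/rowP => i; have := P0 i.
by rewrite coef_poly ltn_ord inord_val coef0 mxE.
Qed.

(** Once a power of the variable is removed, the annihilator has a nonzero constant term, and
    solving for that term exhibits the inverse. *)
Lemma ev_inv (r : {poly k}) : exists r', ev r' = (ev r)^-1.
Proof.
have [->|x0] := eqVneq (ev r) 0.
  by exists 0; rewrite invr0 /ev rmorph0 horner0.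
have [P [P0 _ Px]] := bounded_degree_annihilator r.
have [m [Q]] := multiplicity_XsubC P 0; rewrite P0 /= => Q0 PQ.
have Qx : root (map_poly iota Q) (ev r).
  move: Px; rewrite PQ subr0 rmorphM rmorphXn /= map_polyX rootM.
  case/orP => // /rootP; rewrite hornerXn => /eqP.
  by rewrite expf_eq0 (negbTE x0) andbF.
have [S] : exists S, Q - Q.[0]%:P = S * ('X - 0%:P).
  by apply/factor_theorem; rewrite rootE !hornerE subrr.
rewrite subr0 => /eqP; rewrite subr_eq => /eqP QS.
have /rootP := Qx; rewrite QS rmorphD rmorphM /= map_polyX map_polyC !hornerE => /eqP.
rewrite addr_eq0 => /eqP SE.
exists (- Q.[0]^-1 *: (S \Po r)).
rewrite /ev linearZ /= map_comp_poly hornerZ horner_comp -/(ev r).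
have c0 : iota Q.[0] != 0 by rewrite fmorph_eq0.
apply: (mulIf x0); rewrite -mulrA SE mulVf // rmorphN fmorphV /=.
by rewrite mulrNN mulVf.
Qed.

(** Two terms of an annihilating relation have equal absolute value, so a power of [nu (ev r)] with
    exponent [j - i <= d] is a power of [p]; the factorial of [d] is a multiple of all such
    exponents. *)
Lemma ev_value (r : {poly k}) : ev r != 0 ->
  exists j : int, nu (ev r) ^+ d`! = p%:R ^ j.
Proof.
move=> x0; have [P [P0 sP /rootP Px]] := bounded_degree_annihilator r.
rewrite (horner_coef_wide (n := d.+1)) ?size_map_poly // in Px.
have [|i [j [ij ti tij]]] := absval_sum_eq nuP Px.
  have [i Pi] : exists i : 'I_d.+1, P`_i != 0.
    have sP1 : ((size P).-1 < d.+1)%N by rewrite prednK ?size_poly_gt0.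
    by exists (Ordinal sP1); rewrite /= -lead_coefE lead_coef_eq0.
  by exists i; rewrite coef_map mulf_neq0 ?fmorph_eq0 ?expf_neq0.
have nx0 : nu (ev r) != 0 by rewrite absval_eq0.
have tj : iota P`_j * ev r ^+ j != 0.
  by rewrite -(absval_gt0 nuP) -coef_map -tij absval_gt0.
move: ti tij; rewrite !coef_map !(absvalM nuP) !(absvalX nuP) !nu_iota /= => ti tij.
have Pi0 : P`_i != 0 by apply: contraNneq ti => ->; rewrite rmorph0 mul0r.
have Pj0 : P`_j != 0 by apply: contraNneq tj => ->; rewrite rmorph0 mul0r.
have [a aE] := k_value Pi0; have [b bE] := k_value Pj0.
have p0 : p%:R != 0 :> R by rewrite pnatr_eq0 -lt0n prime_gt0.
have xij : nu (ev r) ^+ (j - i) = p%:R ^ (a - b).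
  rewrite expfzDr // -invr_expz -aE -bE; apply: (mulfI (expf_neq0 i nx0)).
  rewrite -exprD subnKC; last exact: ltnW.
  have Pjn : nuk P`_j != 0 by rewrite (absval_eq0 nukP).
  by apply: (mulfI Pjn); rewrite -tij; field.
have /dvdnP[c ->] : (j - i %| d`!)%N.
  by apply: dvdn_fact; rewrite subn_gt0 ij leq_subLR (leq_trans (leq_ord j)) ?leq_addl.
exists ((a - b) * c%:Z); rewrite mulnC exprM xij.
by rewrite -exprz_exp exprnP.
Qed.

(** By [ev_value] the values are discrete: [D] is the valuation ring of the field formed by the
    [ev r], and [pi] has the least positive exponent [j0]. *)
Lemma discrete_valring : exists (D : K -> Prop) (pi : K),
  [/\ is_subring D, forall x, D x -> valring nu x,
      pi != 0 /\ nu pi < 1,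
      forall x, D x -> nu x < 1 -> D (x / pi) &
      forall r, valring nu (ev r) -> D (ev r)].
Proof.
pose E x := exists r, x = ev r; pose D x := valring nu x /\ E x.
have evB r r' : ev r - ev r' = ev (r - r') by rewrite /ev rmorphB hornerD hornerN.
have evM r r' : ev r * ev r' = ev (r * r') by rewrite /ev rmorphM hornerM.
have VP := valring_subring nuP.
have p1 : 1 < p%:R :> R by rewrite ltr1n prime_gt1.
have p0 : 0 < p%:R :> R := lt_trans ltr01 p1.
pose Dd := d`!; have Dd0 : (0 < Dd)%N := fact_gt0 d.
have ex : exists j, `[< (0 < j)%N /\ exists r, nu (ev r) ^+ Dd = p%:R ^- j >].
  exists Dd; apply/asboolP; split=> //; exists p%:R.
  by rewrite /ev rmorph_nat -polyC_natr hornerC nuKp exprVn.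
case: (ex_minnP ex) => j0 /asboolP[j00 [rpi piE]] jmin.
have pi0 : ev rpi != 0.
  apply/eqP => e; move: piE; rewrite e absval0 // expr0n gtn_eqF // => /eqP.
  by rewrite eq_sym invr_eq0 expf_eq0 gt_eqF // andbF.
exists D, (ev rpi); split.
- split=> [|x y' [x1 [r rE]] [y1 [r' r'E]]|x y' [x1 [r rE]] [y1 [r' r'E]]].
  + by split; [exact: subring1|exists 1; rewrite /ev rmorph1 hornerE].
  + by split; [exact: (subringB VP)|exists (r - r'); rewrite rE r'E].
  + by split; [exact: (subringM VP)|exists (r * r'); rewrite rE r'E].
- by move=> x [].
- have small : nu (ev rpi) < 1.
    rewrite -(ltr_pXn2r Dd0) ?nnegrE ?(absval_ge0 nuP) // ?expr1n.
    by rewrite piE invf_lt1 ?exprn_gt0 // exprn_egt1 // -lt0n.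
  by split.
- move=> x [x1 [r rE]] x_lt1; split; last first.
    by have [r' r'E] := ev_inv rpi; exists (r * r'); rewrite -evM -rE r'E.
  have [->|x0] := eqVneq x 0; first by rewrite mul0r; exact: subring0.
  rewrite /valring absvalM // absvalV // ler_pdivrMr ?absval_gt0 // mul1r.
  have [j jE] : exists j : int, nu x ^+ Dd = p%:R ^ j by rewrite rE; apply: ev_value; rewrite -rE.
  have xD : nu x ^+ Dd < 1 by rewrite exprn_ilt1 ?absval_ge0 // -lt0n.
  case: j jE => j jE; first by move: xD; rewrite jE ltNge exprn_ege1 // ltW.
  have /jmin jj : `[< (0 < j.+1)%N /\ exists r, nu (ev r) ^+ Dd = p%:R ^- j.+1 >].
    by apply/asboolP; split=> //; exists r; rewrite -rE jE.
  rewrite -(ler_pXn2r Dd0) ?nnegrE ?(absval_ge0 nuP) // jE piE NegzE.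
  by rewrite lef_pV2 ?posrE ?exprn_gt0 // ler_weXn2l // ltW.
- by move=> r r1; split=> //; exists r.
Qed.

End SimpleExtension.

(** Finitely many algebraic approximations lie in one simple extension, whose valuation ring is
    discrete. *)
Lemma discrete_approximation (l : seq K) (e : R) : 0 < e -> [pchar k] =i pred0 ->
  (forall x, x \in l -> valring nu x) ->
  exists (D : K -> Prop) (pi : K),
  [/\ is_subring D, forall x, D x -> valring nu x,
      pi != 0 /\ nu pi < 1,
      forall x, D x -> nu x < 1 -> D (x / pi) &
      forall x, x \in l -> exists2 x', D x' & nu (x - x') <= e].
Proof.
move=> e0 char0 l1.
(* An error below 1 keeps the approximations integral. *)
have e10 : 0 < Num.min e 1 by rewrite lt_min e0 ltr01.
have [f fP] := choice (fun x => let: ex_intro2 x' a b := algebraic_dense x e10 in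
  ex_intro (fun x' => algebraicOver iota x' /\ nu (x - x') < Num.min e 1) x' (conj a b)).
have [|//|y [A A0 Ay] yl] := @primitive_element (map f l).
  by move=> _ /mapP[x _ ->]; exact: (fP x).1.
have [D [pi [DP D1 pi01 Ddiv Dev]]] := discrete_valring A0 Ay.
exists D, pi; split=> // x xl; have [_] := fP x; rewrite lt_min => /andP[xe x1].
have [r rE] := yl _ (map_f f xl).
exists (f x); last exact: ltW.
by rewrite -rE; apply: Dev; rewrite rE; apply: (absval_le_close nuP) (l1 _ xl); rewrite absvalBC // ltW.
Qed.

End AlgebraicElements.

(** * Specialization to C_p *)

Section CpFacts.
Variables (R : realType) (p : nat).
Hypothesis p_prime : prime p.
Variables (Cp : fieldType) (nu : Cp -> R).
Hypothesis hCp : is_Cp p nu.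

Lemma Cp_absval : [/\ nonarch_absval nu, absval_complete nu & nu p%:R = p%:R^-1].
Proof.
have [Qp [L [nuQp [nuL [f [g [h [cQp _ nuLP nuLg [nuP complete nuh _]]]]]]]]] := hCp.
by split=> //; rewrite -(rmorph_nat h) nuh -(rmorph_nat g) nuLg (absval_p p_prime cQp).
Qed.

Lemma Cp_residue x : valring nu x ->
  exists2 S : nat, (0 < S)%N & nu (x ^+ (p ^ S) - x) < 1.
Proof.
have [Qp [L [nuQp [nuL [f [g [h [cQp [_ Lalg] nuLP nuLg [nuP complete nuh dense]]]]]]]]] := hCp.
have [nuQpP _ _ _] := cQp.
apply: (residue_algebraic p_prime (iota := h \o g) nuQpP nuP) => [y|||y e e0] /=.
- by rewrite nuh nuLg.
- exact: absval_p cQp.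
- exact: padic_digit cQp.
have [x' yx'] := dense y e e0; exists (h x') => //.
have [P P0 Px] := Lalg x'; exists P => //.
by rewrite map_poly_comp fmorph_root.
Qed.

Lemma Cp_discrete_approximation (l : seq Cp) (e : R) : 0 < e ->
  (forall x, x \in l -> valring nu x) ->
  exists (D : Cp -> Prop) (pi : Cp),
  [/\ is_subring D, forall x, D x -> valring nu x,
      pi != 0 /\ nu pi < 1,
      forall x, D x -> nu x < 1 -> D (x / pi) &
      forall x, x \in l -> exists2 x', D x' & nu (x - x') <= e].
Proof.
move=> e0 l1.
have [Qp [L [nuQp [nuL [f [g [h [cQp [_ Lalg] nuLP nuLg [nuP complete nuh dense]]]]]]]]] := hCp.
have [nuQpP _ _ _] := cQp.
apply: (discrete_approximation p_prime (iota := h \o g) nuQpP nuP) => //= [y|||y e' e'0|].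
- by rewrite nuh nuLg.
- exact: absval_p cQp.
- exact: padic_value cQp.
- have [x' yx'] := dense y e' e'0; exists (h x') => //.
  have [P P0 Px] := Lalg x'; exists P => //.
  by rewrite map_poly_comp fmorph_root.
- by move=> n; rewrite (fmorph_pchar f) pchar_num.
Qed.

End CpFacts.

Lemma lift_vec_scale (K : fieldType) (N q : nat) (t : K) (P : 'I_N.+1 -> mpoly N.+1 K)
    (a : K) (x : 'rV[K]_N.+1) :
  (forall i, P i \is ishomog1 q mdeg) ->
  lift_vec q t P (a *: x) = a ^+ q *: lift_vec q t P x.
Proof.
move=> P_homog; apply/rowP => i; rewrite !mxE (meval_dhomog _ _ (P_homog i)) exprMn.
by rewrite mulrDr; congr (_ + _); rewrite mulrCA.
Qed.

(** * Backward orbits *)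

(** The power [q ^ k] contracts differences of size at most [r] by [r ^ k], so the approximants
    [u n i k] of [z n i] form a Cauchy sequence with explicit rate. *)
Lemma compatible_lift (R : realType) (K : fieldType) (nu : K -> R) (N p s0 : nat) (r : R)
    (w : nat -> 'I_N -> K) :
  nonarch_absval nu -> absval_complete nu -> prime p -> (0 < s0)%N ->
  0 < r < 1 -> nu p%:R <= r -> (forall n, valring_point nu (w n)) ->
  (forall n i, nu (w n i - w n.+1 i ^+ (p ^ s0)) <= r) ->
  exists z : nat -> 'I_N -> K, [/\ forall n, valring_point nu (z n),
    forall n i, z n i = z n.+1 i ^+ (p ^ s0) &
    forall n i, nu (w n i - z n i) <= r].
Proof.
move=> nuP complete p_prime s0_gt0 /andP[r0 r1] pr w_int wr; set q := (p ^ s0)%N.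
have p0 := prime_gt0 p_prime.
have VP := valring_subring nuP.
have wX n k i : valring nu (w n i ^+ k) by exact/(subringX VP)/w_int.
pose u n i k := w (n + k)%N i ^+ (q ^ k).
have ler_rX a b : (a <= b)%N -> r ^+ b <= r ^+ a.
  by move=> ab; rewrite ler_wiXn2l // ltW.
have contract x y k c : valring nu x -> valring nu y -> c <= r -> nu (x - y) <= c ->
    nu (x ^+ (q ^ k) - y ^+ (q ^ k)) <= r ^+ k * c.
  move=> x1 y1 cr xy; rewrite /q -expnM.
  apply: le_trans (absval_subX_primeX nuP (s0 * k) p0 x1 y1 pr (ltW r1) cr xy) _.
  by rewrite ler_wpM2r ?(le_trans (absval_ge0 nuP _) xy) // ler_rX // leq_pmull.
have u_step n i k : nu (u n i k - u n i k.+1) <= r ^+ k.+1.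
  by rewrite /u expnS exprM addnS exprSr; apply: contract => //; exact: w_int.
have u_cauchy n i k l : nu (u n i k - u n i (k + l)%N) <= r ^+ k.+1.
  elim: l => [|l IHl]; first by rewrite addn0 subrr absval0 // exprn_ge0 // ltW.
  apply: (absval_le_trans nuP IHl); rewrite addnS (le_trans (u_step _ _ _)) //.
  by rewrite ler_rX // ltnS leq_addr.
have lim (ni : nat * 'I_N) : exists l, forall k, nu (u ni.1 ni.2 k - l) <= r ^+ k.+1.
  case: ni => n i; have [e e0|l] := complete (u n i).
    have [|//|k0 k0P] := @expr_eventually_le _ r (e / 2); rewrite ?(ltW r0) ?divr_gt0 //.
    exists k0 => k l kk ll; apply: (absval_lt_trans nuP (y := u n i k0)).
      rewrite absvalBC // -(subnKC kk) (le_lt_trans (u_cauchy _ _ _ _)) //.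
      by rewrite (le_lt_trans (k0P _ (leqnSn _))) // ltr_pdivrMr // mulr_natr mulr2n ltrDl.
    rewrite -(subnKC ll) (le_lt_trans (u_cauchy _ _ _ _)) //.
    by rewrite (le_lt_trans (k0P _ (leqnSn _))) // ltr_pdivrMr // mulr_natr mulr2n ltrDl.
  move=> /cvgrPdist_le ul; exists l => k /=.
  have [m _ mP] := ul _ (exprn_gt0 k.+1 r0).
  have := mP (m + k)%N (leq_addr _ _); rewrite /= sub0r normrN ger0_norm ?absval_ge0 //.
  by apply: (absval_le_trans nuP); rewrite addnC; exact: u_cauchy.
have [f fP] := choice lim; pose z n i := f (n, i).
have zP n i k : nu (u n i k - z n i) <= r ^+ k.+1 by exact: (fP (n, i)).
have wz n i : nu (w n i - z n i) <= r.
  by have := zP n i 0; rewrite /u addn0 expn0 expr1 expr1.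
have z_int n : valring_point nu (z n).
  move=> i; apply: (absval_le_close nuP) (w_int n i).
  by rewrite absvalBC // (le_trans (wz n i)) // ltW.
exists z; split=> // n i; apply/eqP; rewrite -subr_eq0 -(absval_eq0 nuP) eq_le absval_ge0 // andbT.
rewrite leNgt; apply/negP => zz.
have [||k kP] := @expr_eventually_le _ r (nu (z n i - z n.+1 i ^+ q) / 2).
- by rewrite ltW.
- by rewrite divr_gt0.
have : nu (z n i - z n.+1 i ^+ q) <= r ^+ k.
  apply: (absval_le_trans nuP (y := u n i k.+1)).
    by rewrite absvalBC // (le_trans (zP _ _ _)) // ler_rX // ltnW.
  (* The approximants of [z n] are the [q]-th powers of those of [z (n + 1)], which passes to the
     limit. *)
  have -> : u n i k.+1 = u n.+1 i k ^+ q by rewrite /u -exprM -expnSr addnS.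
  apply: absval_subX => //; first by rewrite exprn_ge0 // ltW.
    exact: wX.
    exact: z_int.
  by rewrite (le_trans (zP _ _ _)) // ler_rX.
move=> /le_trans/(_ (kP _ (leqnn _))).
by rewrite leNgt ltr_pdivrMr // mulr_natr mulr2n ltrDl zz.
Qed.

(** * Homogeneous polynomials along a backward orbit *)

Section FrobeniusOrbit.
Variables (R : realType) (p : nat).
Hypothesis p_prime : prime p.
Variables (K : fieldType) (nu : K -> R).
Hypothesis hK : is_Cp p nu.
Variables (N s0 : nat) (t : K) (P : 'I_N.+1 -> mpoly N.+1 K).
Hypotheses (s0_gt0 : (0 < s0)%N) (t_small : nu t < 1).
Let q := (p ^ s0)%N.
Hypotheses (P_homog : forall i, P i \is ishomog1 q mdeg)
  (P_int : forall i, poly_over (valring nu) (P i)).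
Let Phi := lift_vec q t P.
Implicit Types (x : 'rV[K]_N.+1) (G : mpoly N.+1 K).
Variable w : nat -> 'rV[K]_N.+1.
Hypothesis w_int : forall n, valring_point nu (w n 0).
Variable c : nat -> K.
Hypotheses (c_unit : forall n, nu (c n) = 1)
  (w_orbit : forall n, Phi (w n.+1) = c n *: w n).

Let nuP : nonarch_absval nu. Proof. by case: (Cp_absval p_prime hK). Qed.
Let VP := valring_subring nuP.
Let r := Num.max (nu p%:R) (nu t).
Let p_pos : 0 < nu p%:R.
Proof.
by have [_ _ ->] := Cp_absval p_prime hK; rewrite invr_gt0 ltr0n prime_gt0.
Qed.
Let r01 : 0 < r < 1.
Proof.
rewrite lt_max p_pos gt_max t_small andbT /=.
have [_ _ ->] := Cp_absval p_prime hK.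
by rewrite invf_lt1 ?ltr1n ?ltr0n ?prime_gt1 ?prime_gt0.
Qed.
Let pr : nu p%:R <= r. Proof. by rewrite le_max lexx. Qed.
Let tr : nu t <= r. Proof. by rewrite le_max lexx orbT. Qed.

Lemma lift_vec_int x : valring_point nu (x 0) -> valring_point nu (Phi x 0).
Proof.
move=> x1 i; rewrite mxE; apply: (subringD VP); first exact/(subringX VP)/x1.
apply: (subringM VP); first exact: ltW.
by apply: absval_meval_le => // m; exact: P_int.
Qed.

Lemma iter_lift_vec_int j x :
  valring_point nu (x 0) -> valring_point nu (iter j Phi x 0).
Proof. by move=> x1; elim: j => //= j; exact: lift_vec_int. Qed.

(** The power map contributes a factor [r ^ s0 <= r], the perturbation a factor [nu t <= r]. *)
Lemma lift_vec_contract x x' d : valring_point nu (x 0) -> valring_point nu (x' 0) ->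
  d <= r -> (forall i, nu (x 0 i - x' 0 i) <= d) ->
  forall i, nu (Phi x 0 i - Phi x' 0 i) <= r * d.
Proof.
move=> x1 x'1 dr xx' i; have d0 : 0 <= d := le_trans (absval_ge0 nuP _) (xx' i).
have [r0 /ltW r1] := andP r01.
rewrite !mxE opprD addrACA -mulrBr; apply: absvalD_le => //.
  rewrite /q; have := absval_subX_primeX nuP s0 (prime_gt0 p_prime) (x1 i) (x'1 i) pr r1 dr (xx' i).
  move=> /le_trans; apply; rewrite ler_wpM2r // -[X in _ <= X]expr1.
  by rewrite ler_wiXn2l // ltW.
rewrite absvalM // ler_pM ?(absval_ge0 nuP) //; exact: absval_meval_sub.
Qed.

Lemma iter_lift_vec_contract j x x' :
  valring_point nu (x 0) -> valring_point nu (x' 0) ->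
  (forall i, nu (x 0 i - x' 0 i) <= r) ->
  forall i, nu (iter j Phi x 0 i - iter j Phi x' 0 i) <= r ^+ j.+1.
Proof.
have [r0 /ltW r1] := andP r01.
move=> x1 x'1 xx'; elim: j => [|j IHj]; first by rewrite expr1.
rewrite exprS /=; apply: lift_vec_contract; [exact: iter_lift_vec_int|exact: iter_lift_vec_int| |exact: IHj].
by rewrite exprS ler_piMr ?exprn_ile1 // ltW.
Qed.

Lemma iter_orbit n j : exists2 a, nu a = 1 & iter j Phi (w (n + j)) = a *: w n.
Proof.
elim: j n => [|j IHj] n; first by exists 1; rewrite ?absval1 // addn0 scale1r.
have [a a1 aE] := IHj n.+1; exists (a ^+ q * c n).
  by rewrite absvalM // absvalX // a1 expr1n mul1r.
by rewrite addnS -addSn /= aE /Phi lift_vec_scale // -/Phi w_orbit scalerA.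
Qed.

Definition lift_mpoly : (N.+1).-tuple (mpoly N.+1 K) :=
  [tuple mpolyX K (mnm_muln (mnm1 i) q) + t *: P i | i < N.+1].

Lemma meval_lift_mpoly x G : meval (x 0) (comp_mpoly lift_mpoly G) = meval (Phi x 0) G.
Proof.
rewrite meval_comp; congr (meval _ G); apply: funext => i.
by rewrite tnth_mktuple mxE mevalD mevalZ -mpolyXn rmorphXn /= mevalXU.
Qed.

Lemma meval_iter_lift_mpoly j x G :
  meval (x 0) (iter j (comp_mpoly lift_mpoly) G) = meval (iter j Phi x 0) G.
Proof. by elim: j x => //= j IHj x; rewrite meval_lift_mpoly IHj -iterSr. Qed.

Lemma iter_lift_mpoly_over j G : poly_over (valring nu) G ->
  poly_over (valring nu) (iter j (comp_mpoly lift_mpoly) G).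
Proof.
move=> G1; elim: j => //= j IHj; apply: poly_over_comp => // i.
rewrite tnth_mktuple; apply: (subringD (poly_over_subring _ VP)).
  exact: poly_overX.
by apply: poly_overZ => //; exact: ltW.
Qed.

Lemma orbit_step n i : (exists J, forall n, w n 0 J = 1) ->
  nu (w n 0 i - w n.+1 0 i ^+ q) <= r.
Proof.
move=> [J wJ]; have orb l : w n.+1 0 l ^+ q + t * meval (w n.+1 0) (P l) = c n * w n 0 l.
  by have /rowP/(_ l) := w_orbit n; rewrite !mxE.
have tP l : nu (t * meval (w n.+1 0) (P l)) <= r.
  apply: le_trans tr; rewrite mulrC absvalM_le //.
  by apply: absval_meval_le => // m; exact: P_int.
(* At the coordinate [J], fixed to 1, the orbit equation determines the scalar [c n] as 1 plus a
   multiple of [t]. *)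
have c1 : nu (c n - 1) <= r.
  have := orb J; rewrite !wJ expr1n mulr1 => <-.
  by rewrite addrAC subrr add0r.
have -> : w n 0 i - w n.+1 0 i ^+ q = t * meval (w n.+1 0) (P i) - w n 0 i * (c n - 1).
  by rewrite mulrBr mulr1 (mulrC (w n 0 i)) -orb; ring.
by apply: absvalB_le => //; apply: absvalM_le => //; exact: w_int.
Qed.

Hypothesis w_unit : exists J, forall n, w n 0 J = 1.

(** The period [s] depends on the orbit only, not on [G]. For each [e], composing [G] with an
    iterate of the lift moves the class to the multiples of [s], and approximating the coefficients
    reduces to [small_often_small_always]. *)
Lemma class_vanishing : exists2 s, (0 < s)%N &
  forall d G, G \is ishomog1 d mdeg -> poly_over (valring nu) G ->
  forall n1, (forall e n0, 0 < e -> exists n, [/\ (n0 <= n)%N, n = n1 %[mod s] &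
    nu (meval (w n 0) G) <= e]) ->
  meval (w n1 0) G = 0.
Proof.
have [r0 r1] := andP r01; have [_ complete nu_p] := Cp_absval p_prime hK.
have p_small : nu p%:R < 1 by apply: le_lt_trans pr r1.
have [z [z_int z_compat wz]] := compatible_lift nuP complete p_prime s0_gt0 r01 pr
  w_int (fun n i => orbit_step n i w_unit).
have residue y : valring nu y -> exists2 S, (0 < S)%N & nu (y ^+ (q ^ S) - y) < 1.
  move=> y1; have [S S0 yS] := Cp_residue p_prime hK y1.
  by exists S; rewrite // /q -expnM mulnC expnM absval_fixX.
have [s s_gt0 s_stable] := topnil_stable nuP z_int.
exists s => // d G G_homog G_int n1 often.
suff small e : 0 < e -> e <= 1 -> nu (meval (w n1 0) G) <= e.
  apply/eqP; rewrite -(absval_eq0 nuP) eq_le absval_ge0 // andbT leNgt; apply/negP => Gw.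
  have e0 : 0 < Num.min 1 (nu (meval (w n1 0) G) / 2) by rewrite lt_min ltr01 divr_gt0.
  have := small _ e0; rewrite ge_min lexx => /(_ isT).
  rewrite le_min => /andP[_].
  by rewrite leNgt ltr_pdivrMr // mulr_natr mulr2n ltrDl Gw.
(* The factor [nu p] leaves a margin for [pi], which is chosen only after [eta]. *)
move=> e0 e1; pose eta := nu p%:R * e.
have eta0 : 0 < eta by rewrite mulr_gt0.
have eta_e : eta <= e by rewrite ler_piMl ?ltW.
have [|//|a aP] := @expr_eventually_le _ r eta; first by rewrite ltW.
(* This makes [n1 + j] a multiple of [s], with [j >= a] so that the contraction error is at most
   [eta]. *)
pose j := (s * (a + n1) - n1)%N.
have jn1 : (n1 + j = s * (a + n1))%N.
  by rewrite subnKC // (leq_trans (leq_addl a n1)) // leq_pmull.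
have aj : (a <= j)%N by rewrite leq_subRL -?jn1 ?leq_addr // addnC jn1 leq_pmull.
pose zr n : 'rV[K]_N.+1 := \row_i z n i.
have zrE n : zr n 0 = z n by apply: funext => i; rewrite mxE.
pose Gj := iter j (comp_mpoly lift_mpoly) G.
have Gj_int : poly_over (valring nu) Gj := iter_lift_mpoly_over j G_int.
have Gj_w n : nu (meval (w (n + j) 0) Gj) = nu (meval (w n 0) G).
  rewrite meval_iter_lift_mpoly; have [b b1 ->] := iter_orbit n j.
  by rewrite (meval_dhomog _ _ G_homog) absvalM // absvalX // b1 expr1n mul1r.
have Gj_wz n : nu (meval (w (n + j) 0) Gj - meval (z (n + j)) Gj) <= eta.
  rewrite -zrE !meval_iter_lift_mpoly.
  have zr_int m : valring_point nu (zr m 0) by rewrite zrE.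
  apply: absval_meval_sub => //; [exact: ltW|exact: iter_lift_vec_int|exact: iter_lift_vec_int|] => i.
  apply: le_trans (iter_lift_vec_contract _ _ _ _ _) (aP _ _) => //.
    by move=> i'; rewrite zrE.
  exact: leq_trans aj (leqnSn _).
have [|D [pi [DP D1 [pi0 pi1] Ddiv Dapp]]] := @Cp_discrete_approximation _ _ p_prime _ _ hK
  [seq mcoeff m Gj | m <- msupp Gj] eta eta0.
  by move=> _ /mapP[m _ ->]; exact: Gj_int.
have D0 : D 0 by exact: subring0.
have [f fP] : exists f : K -> K, forall u : K, u \in [seq mcoeff m Gj | m <- msupp Gj] ->
    D (f u) /\ nu (u - f u) <= eta.
  have /choice[f fP] (u : K) : exists y, u \in [seq mcoeff m Gj | m <- msupp Gj] ->
      D y /\ nu (u - y) <= eta.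
    have [ul|_] := boolP (u \in _); last by exists 0.
    by have [y Dy uy] := Dapp u ul; exists y.
  by exists f.
pose G' := \sum_(m <- msupp Gj) f (Gj@_m) *: mpolyX K m.
have G'E m : G'@_m = if m \in msupp Gj then f (Gj@_m) else 0.
  exact: mcoeff_sumX (fun m => f (Gj@_m)) _ (msupp_uniq _).
have DG' : poly_over D G'.
  by move=> m; rewrite G'E; case: ifP => // mG; apply: (fP _ _).1; exact: map_f.
have G'Gj m : nu ((G' - Gj)@_m) <= eta.
  rewrite mcoeffB G'E absvalBC //; case: ifPn => [mG|/memN_msupp_eq0 ->].
    by apply: (fP _ _).2; exact: map_f.
  by rewrite subrr absval0 // ltW.
have G'_z n : nu (meval (z n) G' - meval (z n) Gj) <= eta.
  by rewrite -mevalB; apply: absval_meval_le => //; exact: ltW.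
have p_pi : nu p%:R <= nu pi.
  by apply: (discrete_le nuP D1 pi0 Ddiv) => //; exact: subring_nat.
(* As [|p| <= |pi|], some power of [|pi|] lies between [|p| e] and [e]. *)
have [l [eta_l l_e]] : exists l, eta <= nu pi ^+ l /\ nu pi ^+ l <= e.
  have ex : exists l, nu pi ^+ l <= e.
    have [|//|l lP] := @expr_eventually_le _ (nu pi) e; last by exists l; exact: lP.
    by rewrite absval_ge0.
  case: (ex_minnP ex) => -[|l] le lmin.
    by exists 0%N; split=> //; rewrite expr0 (le_trans eta_e).
  exists l.+1; split=> //; rewrite exprS ler_pM ?(ltW p_pos) ?(ltW e0) //.
  by rewrite leNgt; apply/negP => /ltW/lmin; rewrite ltnn.
have often' k0 : exists2 k, (k0 <= k)%N & nu (meval (z (s * k)%N) G') <= nu pi ^+ l.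
  have [n [nk nn1 Gn]] := often eta (k0 * s)%N eta0.
  (* As [n] and [n1] agree modulo [s], the same [j] carries [n] to a multiple of [s]. *)
  have sn : (s %| n + j)%N by rewrite /dvdn -modnDml nn1 modnDml jn1 modnMr.
  exists ((n + j) %/ s)%N; first by rewrite leq_divRL // (leq_trans nk) ?leq_addr.
  rewrite mulnC divnK //; apply: le_trans eta_l.
  apply: (absval_le_close nuP (G'_z _)); apply: (absval_le_close nuP (y := meval (w (n + j) 0) Gj)).
    by rewrite absvalBC.
  by rewrite Gj_w.
have G'_small := small_often_small_always nuP p_prime p_small s0_gt0 residue
  z_int z_compat s_gt0 s_stable DP D1 pi0 pi1 Ddiv DG' often'.
rewrite -Gj_w; apply: (absval_le_close nuP (y := meval (z (n1 + j)%N) Gj)).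
  exact: le_trans (Gj_wz _) eta_e.
apply: (absval_le_close nuP (y := meval (z (n1 + j)%N) G')).
  by rewrite absvalBC // (le_trans (G'_z _)).
by rewrite jn1 (le_trans (G'_small _)).
Qed.

End FrobeniusOrbit.

(** Modulo the maximal ideal the lift is the coordinatewise [q]-th power, so a coordinate which is a
    unit at [b 0] stays a unit along the whole orbit and can be scaled to 1 at every index. *)
Lemma normalized_orbit (R : realType) (K : fieldType) (nu : K -> R) (N q : nat) (t : K)
    (P : 'I_N.+1 -> mpoly N.+1 K) (F : proj_space K N -> proj_space K N)
    (b : nat -> proj_space K N) :
  nonarch_absval nu -> (0 < q)%N -> nu t < 1 ->
  (forall i, P i \is ishomog1 q mdeg) -> (forall i, poly_over (valring nu) (P i)) ->
  (forall x : nzvec K N, exists2 y : nzvec K N,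
     val y = lift_vec q t P (val x) & F (pt x) = pt y) ->
  (forall i, F (b i.+1) = b i) ->
  exists (X : nat -> nzvec K N) (c : nat -> K),
  [/\ forall n, pt (X n) = b n, forall n, valring_point nu (val (X n) 0),
      forall n, nu (c n) = 1,
      forall n, lift_vec q t P (val (X n.+1)) = c n *: val (X n) &
      exists J, forall n, val (X n) 0 J = 1].
Proof.
move=> nuP q0 t1 P_homog P_int FP hb.
have VP := valring_subring nuP.
have /choice[Y YP] n : exists Y : nzvec K N, [/\ pt Y = b n, valring_point nu (val Y 0) &
    exists i, nu (val Y 0 i) = 1].
  by have [[Y YE Yb] Y1 Yu] := normalizedP (b n) nuP; exists Y; rewrite YE; split.
have Y_int n : valring_point nu (val (Y n) 0) by have [] := YP n.
have tP_small n i : nu (t * meval (val (Y n) 0) (P i)) < 1.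
  by rewrite mulrC absvalM_lt //; apply: absval_meval_le => // m; exact: P_int.
have Phi_unit n i : (nu (lift_vec q t P (val (Y n)) 0 i) == 1) = (nu (val (Y n) 0 i) == 1).
  have YX : valring nu (val (Y n) 0 i ^+ q) by exact/(subringX VP)/Y_int.
  rewrite mxE -[RHS](@pexpr_eq1 _ _ q) ?absval_ge0 // -absvalX //; apply/eqP/eqP => e1.
    apply/eqP; rewrite eq_le YX leNgt; apply/negP => small.
    by have := absvalD_lt nuP small (tP_small n i); rewrite e1 ltxx.
  by rewrite -e1; apply: absval_eq; rewrite // opprD addNKr absvalN // e1.
have /choice[a aP] n : exists a, nu a = 1 /\ lift_vec q t P (val (Y n.+1)) = a *: val (Y n).
  have [y yE] := FP (Y n.+1); have [Yb1 _ [i Yi]] := YP n.+1.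
  have [Yb _ [i' Yi']] := YP n.
  rewrite Yb1 hb -Yb => /esym/ptP[a a0 ya]; exists a; split; last by rewrite -yE.
  have Phi_le l : nu (a * val (Y n) 0 l) <= 1.
    have -> : a * val (Y n) 0 l = val y 0 l by rewrite ya mxE.
    rewrite yE mxE; apply: (subringD VP); first exact/(subringX VP)/Y_int.
    exact/ltW/tP_small.
  apply/eqP; rewrite eq_le; apply/andP; split.
    by have := Phi_le i'; rewrite absvalM // Yi' mulr1.
  have := Phi_unit n.+1 i; rewrite Yi eqxx -yE ya mxE absvalM // => /eqP <-.
  by rewrite ler_piMr ?absval_ge0 //; exact: Y_int.
have [_ _ [J YJ0]] := YP 0.
have YJ n : nu (val (Y n) 0 J) = 1.
  elim: n => // n IHn; apply/eqP; rewrite -Phi_unit; have [a1 ->] := aP n.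
  by rewrite mxE absvalM // a1 IHn mul1r.
have YJ_neq0 n : val (Y n) 0 J != 0 by rewrite -(absval_gt0 nuP) YJ.
have X_neq0 n : (val (Y n) 0 J)^-1 *: val (Y n) != 0.
  by rewrite scaler_eq0 negb_or invr_eq0 YJ_neq0 (valP (Y n)).
pose X n : nzvec K N := exist (fun v : 'rV[K]_N.+1 => v != 0) _ (X_neq0 n).
(* The scalar [a n] is corrected by the rescalings of both points, the first one raised to the
   degree [q]. *)
exists X, (fun n => (val (Y n.+1) 0 J)^-1 ^+ q * a n * val (Y n) 0 J); split=> [n|n i|n|n|].
- have [<- _ _] := YP n; apply/ptP.
  by exists (val (Y n) 0 J)^-1; rewrite // invr_eq0.
- by rewrite mxE absvalM // absvalV // YJ invr1 mul1r; exact: Y_int.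
- by rewrite !(absvalM nuP) (absvalX nuP) (absvalV nuP) !YJ invr1 expr1n !mul1r mulr1 (aP n).1.
- have -> : val (X n.+1) = (val (Y n.+1) 0 J)^-1 *: val (Y n.+1) by [].
  rewrite lift_vec_scale // (aP n).2 !scalerA /=.
  by rewrite mulfK //; exact: YJ_neq0.
- by exists J => n; rewrite mxE mulVf.
Qed.

(** Each of the [s] residues either recurs forever or no longer occurs from some index on; [i0]
    exceeds all these indices. *)
Lemma frequent_residue (n : nat -> nat) (s : nat) : (0 < s)%N ->
  exists i0, forall i, (i0 <= i)%N ->
    forall i1, exists2 i', (i1 <= i')%N & n i' = n i %[mod s].
Proof.
move=> s0.
have /choice[g gP] d : exists i0, (forall i1, exists2 i', (i1 <= i')%N & (n i' %% s)%N = d) \/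
    forall i, (i0 <= i)%N -> (n i %% s)%N <> d.
  have [often|/existsNP[i1 i1P]] :=
    pselect (forall i1, exists2 i', (i1 <= i')%N & (n i' %% s)%N = d).
    by exists 0; left.
  by exists i1; right=> i i1i nid; apply: i1P; exists i.
exists (\max_(d < s) g d) => i gi; have ds : (n i %% s < s)%N by rewrite ltn_pmod.
case: (gP (n i %% s)%N) => // /(_ i); case => //; apply: leq_trans gi.
exact: (@leq_bigmax _ (fun d : 'I_s => g d) (Ordinal ds)).
Qed.

Theorem theorem1p8 (R : realType) (p : nat) (p_prime : prime p)
    (Cp : fieldType) (nu : Cp -> R) (hCp : is_Cp p nu) (N : nat)
    (F : proj_space Cp N -> proj_space Cp N) (hF : is_frobenius_lift nu p F)
    (b : nat -> proj_space Cp N) (hb : forall i : nat, F (b i.+1) = b i)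
    (V : set (proj_space Cp N))
    (m : nat) (H : 'I_m -> mpoly.mpoly N.+1 Cp) (hV : defines nu H V)
    (n : nat -> nat) (hn : {homo n : i j / (i < j)%N})
    (hd : (fun i => dist_to nu H (b (n i))) @ \oo --> (0 : R)) :
  (\forall i \near \oo, V (b (n i))) /\
  exists r : nat, range b `<=` \bigcup_(i in `I_r.+1) (iter i F @` V).
Proof.
have [s0 [t [P [s0_gt0 t1 P_homog P_int FP]]]] := hF.
have [nuP _ _] := Cp_absval p_prime hCp.
have q_gt0 : (0 < p ^ s0)%N by rewrite expn_gt0 prime_gt0.
have [X [c [Xb X_int c1 X_orbit X_unit]]] :=
  normalized_orbit nuP q_gt0 t1 P_homog P_int FP hb.
have [H_homog H_norm VE] := hV.
have H_int l : poly_over (valring nu) (H l).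
  move=> k; have [kH|/memN_msupp_eq0 ->] := boolP (k \in msupp (H l)).
    by rewrite /valring -(H_norm l); apply: le_bigmax_seq.
  by rewrite /valring absval0.
have [s s_gt0 sP] := class_vanishing p_prime hCp s0_gt0 t1 P_homog P_int X_int c1 X_orbit X_unit.
have X_norm k : exists i, nu (val (X k) 0 i) = 1.
  by have [J XJ] := X_unit; exists J; rewrite XJ absval1.
have V_of_vanishing k : (forall l, meval (val (X k) 0) (H l) = 0) -> V (b k).
  move=> HX; rewrite VE => l; rewrite -Xb.
  have /ptP[a a0] : pt (repr (pt (X k))) = pt (X k) by rewrite pt_repr.
  rewrite /hcoord => ->; have [d Hd] := H_homog l.
  by rewrite (meval_dhomog _ _ Hd) HX mulr0.
have n_ge i : (i <= n i)%N.
  by elim: i => // i IHi; apply: leq_ltn_trans IHi _; exact: hn.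
(* On a class visited infinitely often, every equation of [V] becomes arbitrarily small, hence
   vanishes on the whole class. *)
have V_class i : (forall i1, exists2 i', (i1 <= i')%N & n i' = n i %[mod s]) ->
    forall k, k = n i %[mod s] -> V (b k).
  move=> often k ki; apply: V_of_vanishing => l; have [d Hd] := H_homog l.
  apply: (sP d) => // e n0 e0; have /cvgrPdist_le/(_ e e0)[i1 _ i1P] := hd.
  have [i'] := often (maxn i1 n0); rewrite geq_max => /andP[i1i' n0i'] ni'.
  exists (n i'); split; [exact: leq_trans (n_ge _)|by rewrite ni' ki|].
  have := i1P i' i1i'; rewrite /= sub0r normrN -Xb (dist_toE nuP H_homog (X_int _) (X_norm _)).
  rewrite ger0_norm ?bigmax_ge_id //; apply: le_trans.
  exact: (le_bigmax _ (fun l : 'I_m => nu (meval (val (X (n i')) 0) (H l))) l).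
have [i0 i0P] := frequent_residue n s_gt0.
split; first by exists i0 => // i /= /i0P often; exact: V_class often _ _.
exists s => _ [k _ <-].
(* The shift [j < s] brings [k] into the class of [n i0], and [b k] is the [j]-th iterated image of
   [b (k + j)]. *)
pose j := ((n i0 + (s - k %% s)) %% s)%N.
have Vj : V (b (k + j)%N).
  apply: (V_class i0 (i0P _ (leqnn _))); rewrite /j modnDmr -modnDml addnCA subnKC.
    by rewrite modnDr.
  by rewrite ltnW // ltn_pmod.
exists j; first by rewrite /= ltnS ltnW // ltn_pmod.
exists (b (k + j)%N) => //.
by elim: (j) => [|j' IHj]; rewrite ?addn0 // iterSr addnS hb.
Qed.
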